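(* Let $E\subset\mathbb R^n$ be the attractor of an iterated function system without rotations, $S_i(x)=\lambda_ix+d_i$ ($i=1,\dots,l$, $\lambda_i\in(0,1)$, $d_i\in\mathbb R^n$), satisfying the open set condition, and suppose that $E$ satisfies the slice coding condition. Let $s$ be the Hausdorff dimension of $E$, and let $\theta$ be such that the projection $\nu_\theta$ of the $s$-dimensional Hausdorff measure on $E$ onto the line $l_\theta$ at angle $\theta$ through the origin is absolutely continuous with bounded density. Then the probability measures $\mu_x^2$, defined for $\nu_\theta$-almost every $x\in\pi_\theta(E)$ as the normalised $(s-1)$-dimensional Hausdorff measure on the slice $E_{\theta,x}$, $$\mu_x^2(A)=\frac{\mathcal H^{s-1}(A)}{\mathcal H^{s-1}(E_{\theta,x})},\qquad A\subset E_{\theta,x},$$ disintegrate the measure $\mathcal H^s$ on $E$; that is, for every $\mathcal H^s|_E$-integrable $f:E\to\mathbb R$, $$\int_Ef\,d\mathcal H^s=\int_{\pi_\theta(E)}\int_{E_{\theta,x}}f\,d\mu_x^2\,d\nu_\theta(x).$$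
   Context: The attractor $E$ is the nonempty compact set with $E=\bigcup_{i=1}^lS_i(E)$. Open set condition: there is a nonempty open $V\subset\mathbb R^n$ with $V\supset\bigcup_{i=1}^lS_i(V)$, the union being disjoint. The Hausdorff dimension $s$ of $E$ then satisfies $\sum_{i=1}^l\lambda_i^s=1$, and $\nu=\mathcal H^s|_E$ is positive and finite. $\theta=(\theta_1,\dots,\theta_{n-1})$ denotes angles determining a line $l_\theta$ through the origin in $\mathbb R^n$; $\pi_\theta$ is orthogonal projection of $\mathbb R^n$ onto $l_\theta$, with $l_\theta$ identified with $\mathbb R$; $\nu_\theta=\nu\circ\pi_\theta^{-1}$; absolute continuity is with respect to one-dimensional Lebesgue measure, and bounded means essentially bounded. For $x\in\pi_\theta(E)$, the slice $E_{\theta,x}=E\cap\pi_\theta^{-1}(x)$ is the intersection of $E$ with the $(n-1)$-dimensional plane perpendicular to $l_\theta$ through $x$. $|A|$ denotes Euclidean diameter. Slice coding condition: for all $\theta$ there exists a constant $\delta>0$ such that for all $x\in\pi_\theta(E)$ either $|E_{\theta,x}|>\delta$ or $E_{\theta,x}\subset S_a(E)$ for some $a\in\{1,\dots,l\}$. *)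

(* Defs.v *)
From HB Require Import structures.
From mathcomp Require Import all_boot all_order all_algebra.
From mathcomp Require Import all_classical all_reals all_analysis.
From mathcomp Require Import ess_sup_inf.

Set Implicit Arguments.
Unset Strict Implicit.
Unset Printing Implicit Defensive.
Import Order.TTheory GRing.Theory Num.Theory.
Import numFieldNormedType.Exports.

Local Open Scope classical_set_scope.
Local Open Scope ring_scope.

Section OuterIntegral.
Context {R : realType} {T : pointedType}.
Implicit Types (mu : {outer_measure set T -> \bar R}) (D : set T).

(* An outer measure is integrated over the sigma-algebra of its Caratheodory
   measurable sets, on which it is a complete measure. *)
Definition ointegral mu D (f : T -> \bar R) : \bar R :=
  (\int[(mu : set (caratheodory_type mu) -> \bar R)]_(x in D) f x)%E.

Definition ointegrable mu D (f : T -> \bar R) : Prop :=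
  integrable (T := caratheodory_type mu) mu D f.

Definition oae mu (P : T -> Prop) : Prop :=
  almost_everywhere (T := caratheodory_type mu) mu P.

End OuterIntegral.

Section OuterMeasureConstructions.
Local Open Scope ereal_scope.
Context {R : realType} {T U : Type}.
Variable mu : {outer_measure set T -> \bar R}.

Definition orestr (D : set T) (A : set T) : \bar R := mu (A `&` D).

Definition opush (f : T -> U) (B : set U) : \bar R := mu (f @^-1` B).

(* In the degenerate cases mu D = 0 and mu D = +oo this is the zero measure. *)
Definition onormalize (D : set T) (A : set T) : \bar R := mu (A `&` D) / mu D.

Section orestr.
Variable D : set T.

Let orestr0 : orestr D set0 = 0.
Proof. by rewrite /orestr set0I outer_measure0. Qed.

Let orestr_ge0 A : 0 <= orestr D A.
Proof. exact: outer_measure_ge0. Qed.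

Let le_orestr : {homo orestr D : A B / A `<=` B >-> A <= B}.
Proof. by move=> A B AB; apply: le_outer_measure; exact: setSI. Qed.

Let orestr_sigma_subadditive : sigma_subadditive (orestr D).
Proof.
move=> F; rewrite /orestr setI_bigcupl.
exact: (outer_measure_sigma_subadditive mu (fun n => F n `&` D)).
Qed.

HB.instance Definition _ := isOuterMeasure.Build R T (orestr D)
  orestr0 orestr_ge0 le_orestr orestr_sigma_subadditive.

End orestr.

Section opush.
Variable f : T -> U.

Let opush0 : opush f set0 = 0.
Proof. by rewrite /opush preimage_set0 outer_measure0. Qed.

Let opush_ge0 A : 0 <= opush f A.
Proof. exact: outer_measure_ge0. Qed.

Let le_opush : {homo opush f : A B / A `<=` B >-> A <= B}.
Proof. by move=> A B AB; apply: le_outer_measure; exact: preimage_subset. Qed.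

Let opush_sigma_subadditive : sigma_subadditive (opush f).
Proof.
move=> F; rewrite /opush preimage_bigcup.
exact: (outer_measure_sigma_subadditive mu (fun n => f @^-1` F n)).
Qed.

HB.instance Definition _ := isOuterMeasure.Build R U (opush f)
  opush0 opush_ge0 le_opush opush_sigma_subadditive.

End opush.

Section onormalize.
Variable D : set T.

Let inv_ge0 : 0 <= (mu D)^-1.
Proof.
case E : (mu D) => [r| |] //; last first.
  by have := outer_measure_ge0 mu D; rewrite E.
have r0 : (0 <= r)%R by have := outer_measure_ge0 mu D; rewrite E lee_fin.
by rewrite /inve; case: ifP => // _; rewrite lee_fin invr_ge0.
Qed.

Let onormalize0 : onormalize D set0 = 0.
Proof. by rewrite /onormalize set0I outer_measure0 mul0e. Qed.

Let onormalize_ge0 A : 0 <= onormalize D A.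
Proof. by rewrite /onormalize mule_ge0//; exact: outer_measure_ge0. Qed.

Let le_onormalize : {homo onormalize D : A B / A `<=` B >-> A <= B}.
Proof.
move=> A B AB; rewrite /onormalize lee_wpmul2r//.
by apply: le_outer_measure; exact: setSI.
Qed.

Let onormalize_sigma_subadditive : sigma_subadditive (onormalize D).
Proof.
move=> F; have [D0|D0] := eqVneq (mu D) 0.
  have -> : onormalize D (\bigcup_n F n) = 0; last first.
    by apply: nneseries_ge0 => n _ _.
  rewrite /onormalize (_ : mu _ = 0) ?mul0e//.
  apply/eqP; rewrite eq_le outer_measure_ge0 andbT -D0.
  by apply: le_outer_measure; exact: subIsetr.
have ifin : (mu D)^-1 \is a fin_num.
  case E : (mu D) D0 => [r| |] //; rewrite /inve.
    by rewrite eqe => /negbTE ->.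
  by have := outer_measure_ge0 mu D; rewrite E.
rewrite /onormalize setI_bigcupl muleC -(fineK ifin).
under eq_eseriesr do rewrite muleC.
rewrite nneseriesZl; last by move=> n _; exact: outer_measure_ge0.
rewrite fineK//; apply: lee_wpmul2l => //.
exact: (outer_measure_sigma_subadditive mu (fun n => F n `&` D)).
Qed.

HB.instance Definition _ := isOuterMeasure.Build R T (onormalize D)
  onormalize0 onormalize_ge0 le_onormalize onormalize_sigma_subadditive.

End onormalize.
End OuterMeasureConstructions.

Section Euclidean.
Context {R : realType} {n : nat}.
Implicit Types (x y : 'rV[R]_n) (A : set 'rV[R]_n).

Definition dotp x y : R := \sum_j x ord0 j * y ord0 j.

(* The library's norm on row vectors is the sup norm, hence this definition;
   the topology is the same. *)
Definition enorm x : R := Num.sqrt (dotp x x).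

(* The diameter of the empty set is 0. *)
Definition ediam A : \bar R :=
  ereal_sup (0%E |` [set (enorm (xy.1 - xy.2))%:E | xy in A `*` A]).

End Euclidean.

Section Hausdorff.
Local Open Scope ereal_scope.
Context {R : realType} {n : nat}.
Variable s : R.
Implicit Types (A U : set 'rV[R]_n) (F : (set 'rV[R]_n)^nat).

(* |U|^s; nonempty sets of diameter 0 count for 1 when s = 0, so that the
   0-dimensional measure is the counting measure. *)
Definition hgauge U : \bar R := if `[< U = set0 >] then 0 else poweR (ediam U) s.

Definition hcover (delta : R) A : set ((set 'rV[R]_n)^nat) :=
  [set F | (forall k, ediam (F k) <= delta%:E) /\ A `<=` \bigcup_k F k].

Definition hcontent (delta : R) A : \bar R :=
  ereal_inf [set \sum_(k <oo) hgauge (F k) | F in hcover delta A].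

(* The limit as delta tends to 0 is a supremum. *)
Definition hausdorff A : \bar R :=
  ereal_sup [set hcontent delta A | delta in [set delta : R | (0 < delta)%R]].

End Hausdorff.

(* An auxiliary copy of R^n in which all sets are measurable: the size delta
   content is then an instance of the library's mu_ext. *)
Definition all_measurable (R : realType) (n : nat) : Type := 'rV[R]_n.

Section HausdorffOuter.
Local Open Scope ereal_scope.
Context {R : realType} {n : nat}.

HB.instance Definition _ := Pointed.on (all_measurable R n).
HB.instance Definition _ := @isMeasurable.Build default_measure_display
  (all_measurable R n) discrete_measurable discrete_measurable0
  discrete_measurableC discrete_measurableU.

Variable s : R.

Let pgauge (delta : R) (U : set (all_measurable R n)) : \bar R :=
  if ediam (U : set 'rV[R]_n) <= delta%:E then hgauge s U else +oo.

Lemma hgauge_ge0 (U : set 'rV[R]_n) : 0 <= hgauge s U.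
Proof. by rewrite /hgauge; case: ifP => // _; exact: poweR_ge0. Qed.

Lemma hgauge0 : hgauge s (@set0 'rV[R]_n) = 0.
Proof. by rewrite /hgauge; case: asboolP. Qed.

Lemma ediam0 : ediam (@set0 'rV[R]_n) = 0.
Proof. by rewrite /ediam set0X image_set0 setU0 ereal_sup1. Qed.

Let pgauge_ge0 delta U : 0 <= pgauge delta U.
Proof. by rewrite /pgauge; case: ifP => // _; exact: hgauge_ge0. Qed.

Let pgauge0 delta : (0 < delta)%R -> pgauge delta set0 = 0.
Proof.
by move=> d0; rewrite /pgauge ediam0 lee_fin (ltW d0); exact: hgauge0.
Qed.

Lemma hcontent_mu_ext delta (A : set 'rV[R]_n) : (0 < delta)%R ->
  hcontent s delta A = mu_ext (pgauge delta) (A : set (all_measurable R n)).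
Proof.
move=> d0; apply/eqP; rewrite eq_le; apply/andP; split.
- apply: le_ereal_inf_tmp => _ [F [_ AF] <-].
  have [Fd|] := pselect (forall k, ediam (F k : set 'rV[R]_n) <= delta%:E).
    apply: ereal_inf_lbound; exists F => //.
    by apply: eq_eseriesr => k _; rewrite /pgauge Fd.
  move=> /existsNP[k /negP Fk].
  rewrite (@eseries_pinfty _ (fun k => pgauge delta (F k)) _ k) ?leey//.
    by move=> m _; rewrite -ltNye (lt_le_trans _ (pgauge_ge0 _ _)).
  by rewrite /pgauge (negbTE Fk).
- apply: le_ereal_inf_tmp => _ [F [Fd AF] <-].
  apply: ereal_inf_lbound; exists F; first by split.
  by apply: eq_eseriesr => k _; rewrite /pgauge Fd.
Qed.

Lemma hcontent_ge0 delta (A : set 'rV[R]_n) : 0 <= hcontent s delta A.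
Proof.
apply: le_ereal_inf_tmp => _ [F _ <-].
by apply: nneseries_ge0 => k _ _; exact: hgauge_ge0.
Qed.

Let hausdorff0 : hausdorff s (@set0 'rV[R]_n) = 0.
Proof.
rewrite /hausdorff.
have -> : [set hcontent s delta (@set0 'rV[R]_n) |
    delta in [set delta : R | (0 < delta)%R]] = [set 0].
  apply/seteqP; split => [_ [delta /= d0 <-]|_ ->] /=.
    by rewrite hcontent_mu_ext// mu_ext0//; exact: pgauge0.
  by exists 1%R => //=; rewrite hcontent_mu_ext// mu_ext0//; exact: pgauge0.
exact: ereal_sup1.
Qed.

Let hausdorff_ge0 (A : set 'rV[R]_n) : 0 <= hausdorff s A.
Proof.
apply: (le_trans (hcontent_ge0 1 A)).
by apply: ereal_sup_ubound; exists 1%R => //=.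
Qed.

Let le_hausdorff :
  {homo hausdorff s : A B / (A : set 'rV[R]_n) `<=` B >-> A <= B}.
Proof.
move=> A B AB; apply: ge_ereal_sup => _ [delta /= d0 <-].
apply: (@le_trans _ _ (hcontent s delta B)); last first.
  by apply: ereal_sup_ubound; exists delta.
by rewrite !hcontent_mu_ext//; exact: le_mu_ext.
Qed.

Let hausdorff_sigma_subadditive :
  sigma_subadditive (hausdorff s : set 'rV[R]_n -> \bar R).
Proof.
move=> F; apply: ge_ereal_sup => _ [delta /= d0 <-].
apply: (@le_trans _ _ (\sum_(i <oo) hcontent s delta (F i))).
  rewrite hcontent_mu_ext//.
  under eq_eseriesr do rewrite hcontent_mu_ext//.
  by apply: mu_ext_sigma_subadditive => //; exact: pgauge_ge0.
apply: lee_nneseries => [i _ _|i _]; first exact: hcontent_ge0.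
by apply: ereal_sup_ubound; exists delta.
Qed.

HB.instance Definition _ := isOuterMeasure.Build R 'rV[R]_n (hausdorff s)
  hausdorff0 hausdorff_ge0 le_hausdorff hausdorff_sigma_subadditive.

End HausdorffOuter.

Definition hausdorff_dim {R : realType} {n : nat} (A : set 'rV[R]_n) : \bar R :=
  ereal_inf [set s%:E | s in [set s : R | 0 <= s /\ hausdorff s A = 0%E]].

Section IFS.
Context {R : realType} {n l : nat}.
Variables (lam : 'I_l -> R) (d : 'I_l -> 'rV[R]_n).

Definition simil (i : 'I_l) (x : 'rV[R]_n) : 'rV[R]_n := lam i *: x + d i.

Definition is_attractor (E : set 'rV[R]_n) : Prop :=
  [/\ E !=set0, compact E & E = \bigcup_(i in [set: 'I_l]) (simil i @` E)].

Definition open_set_condition : Prop :=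
  exists V : set 'rV[R]_n,
    [/\ V !=set0, open V, \bigcup_(i in [set: 'I_l]) (simil i @` V) `<=` V
      & trivIset [set: 'I_l] (fun i => simil i @` V)].

End IFS.

Section Slices.
Context {R : realType} {n : nat}.
Implicit Types (theta : 'I_n -> R) (E : set 'rV[R]_n.+1).

(* Hyperspherical coordinates: the unit vector
   (cos t_0, sin t_0 cos t_1, ..., sin t_0 ... sin t_(n-2) cos t_(n-1),
    sin t_0 ... sin t_(n-1)) spanning the line l_theta. *)
Definition ldir theta : 'rV[R]_n.+1 :=
  \row_(j < n.+1) ((\prod_(i < n | (i < j)%N) sin (theta i)) *
                   (if insub (val j) is Some i then cos (theta i) else 1)).

(* l_theta is identified with R through t |-> t *: ldir theta. *)
Definition lproj theta (x : 'rV[R]_n.+1) : R := dotp x (ldir theta).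

Definition slice E theta (x : R) : set 'rV[R]_n.+1 :=
  E `&` lproj theta @^-1` [set x].

Definition slice_coding l (lam : 'I_l -> R) (d : 'I_l -> 'rV[R]_n.+1) E : Prop :=
  forall theta, exists2 delta : R, 0 < delta &
    forall x, (lproj theta @` E) x ->
      (delta%:E < ediam (slice E theta x))%E \/
      exists a, slice E theta x `<=` simil lam d a @` E.

Definition nu_proj (s : R) E theta : set R -> \bar R :=
  opush (orestr (hausdorff s) E) (lproj theta).

HB.instance Definition _ s E theta := OuterMeasure.on (nu_proj s E theta).

Definition mu2 (s : R) E theta (x : R) : set 'rV[R]_n.+1 -> \bar R :=
  onormalize (hausdorff (s - 1)) (slice E theta x).

HB.instance Definition _ s E theta x := OuterMeasure.on (mu2 s E theta x).

End Slices.

Definition ac_bounded_density {R : realType} (nu : set R -> \bar R) : Prop :=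
  nu `<< lebesgue_measure /\
  exists g : R -> R,
    [/\ measurable_fun [set: R] g, forall x, 0 <= g x,
        (ess_sup lebesgue_measure (EFin \o g) < +oo)%E &
        forall B : set R, measurable B ->
          nu B = (\int[lebesgue_measure]_(x in B) (g x)%:E)%E].

(* Main.v *)
Require Import Defs.
From HB Require Import structures.
From mathcomp Require Import all_boot all_order all_algebra.
From mathcomp Require Import all_classical all_reals all_analysis.
From mathcomp Require Import ess_sup_inf.
From mathcomp Require Import measurable_realfun finmap ring lra.

Set Implicit Arguments.
Unset Strict Implicit.
Unset Printing Implicit Defensive.
Import Order.TTheory GRing.Theory Num.Theory.
Import numFieldNormedType.Exports.

Local Open Scope classical_set_scope.
Local Open Scope ring_scope.

(** Write [H] for the Hausdorff measure of dimension [s], [pi] for the projection and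
    [h A x] for the measure of dimension [s - 1] of the slice of [A] over [x]. The
    idea is that integrating the slices over the line gives back the measure: there
    is a constant [K > 0] such that the integral of [h A] over the line is
    [K * H A] for every measurable [A] below [E]. With [A] the part of [E] above a
    Borel set this says that the projected measure has density [h E / K]; hence the
    slices have positive and finite measure over almost every point for the
    projected measure, and the factor [1 / h E x] which normalises the measure on
    the slice cancels the density. Functions follow from sets by monotone limits.

    To see why [K] exists, note that the maps of the system have no rotations, so
    that they send slices to slices. The integral of the slices of a piece of [E]
    with contraction ratio [r] is thus [r `^ (s - 1) * r] times that of [E]
    ([slice_mass_piece]), and both sides scale in the same way. The total integral
    is finite by Eilenberg's inequality ([eilenberg]). By Moran's equation ([moran])
    subadditivity loses nothing on unions of pieces of the same level, and a compact
    set is a decreasing limit of such unions; this gives the upper bound [K * H A]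
    for compact sets ([compact_slice_le]). For measurable sets it follows by inner
    regularity and because the slices of a null set are almost all null
    ([eilenberg_null]). Applied to [A] and to its complement in [E], whose bounds add
    up to the total integral, it becomes an equality ([slice_disintegration]).

    The positivity of [K] is where the bounded density is used. If almost all slices
    were null, they could be covered cheaply, and by compactness such a cover also
    serves the nearby slices ([fcover_tube]). Each member of the cover meets boundedly
    many pieces of its own size, by the open set condition ([cutset_count]), and each
    such piece contributes to the density of the projection at most the bound on
    that density times the gauge of the member ([density_le_slice]). The density
    would vanish, and with it [H E].

    The same count of pieces, together with Kraft's inequality for words ([kraft]),
    gives the lower bound of the mass distribution principle ([hausdorff_gt0]), from
    which Moran's equation follows. If [H E = 0] all the integrals vanish. *)

(** * Euclidean norm and diameter *)

Section EuclideanNorm.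
Context {R : realType} {n : nat}.
Implicit Types (x y : 'rV[R]_n) (A B : set 'rV[R]_n).

Lemma dotp_ge0 x : 0 <= dotp x x.
Proof. by apply: sumr_ge0 => j _; rewrite -expr2 sqr_ge0. Qed.

Lemma enorm_ge0 x : 0 <= enorm x.
Proof. exact: sqrtr_ge0. Qed.

Lemma sqr_enorm x : enorm x ^+ 2 = dotp x x.
Proof. by rewrite sqr_sqrtr// dotp_ge0. Qed.

Lemma dotpDl x y z : dotp (x + y) z = dotp x z + dotp y z.
Proof. by rewrite /dotp -big_split/=; apply: eq_bigr => j _; rewrite mxE mulrDl. Qed.

Lemma dotpC x y : dotp x y = dotp y x.
Proof. by apply: eq_bigr => j _; rewrite mulrC. Qed.

Lemma dotpZl a x z : dotp (a *: x) z = a * dotp x z.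
Proof. by rewrite /dotp mulr_sumr; apply: eq_bigr => j _; rewrite mxE mulrA. Qed.

Lemma dotpBl x y z : dotp (x - y) z = dotp x z - dotp y z.
Proof. by rewrite dotpDl -scaleN1r dotpZl mulN1r. Qed.

Lemma enormZ a x : enorm (a *: x) = `|a| * enorm x.
Proof.
by rewrite /enorm dotpZl dotpC dotpZl mulrA -expr2 sqrtrM ?sqr_ge0// sqrtr_sqr.
Qed.

Lemma enorm0 : enorm (0 : 'rV[R]_n) = 0.
Proof. by rewrite -(scale0r (0 : 'rV[R]_n)) enormZ normr0 mul0r. Qed.

Lemma enormN x : enorm (- x) = enorm x.
Proof. by rewrite -scaleN1r enormZ normrN1 mul1r. Qed.

Lemma enormBC x y : enorm (x - y) = enorm (y - x).
Proof. by rewrite -enormN opprB. Qed.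

Lemma enorm_eq0 x : enorm x = 0 -> x = 0.
Proof.
move=> x0; have : dotp x x = 0 by rewrite -sqr_enorm x0 expr0n.
move=> /eqP; rewrite psumr_eq0; last by move=> j _; rewrite -expr2 sqr_ge0.
move=> /allP h; apply/rowP => j; rewrite mxE.
by have /eqP := h j (mem_index_enum j); rewrite -expr2 => /eqP; rewrite sqrf_eq0 => /eqP.
Qed.

Lemma dotp_CS x y : `|dotp x y| <= enorm x * enorm y.
Proof.
have [y0|y0] := eqVneq (enorm y) 0.
  rewrite y0 mulr0 (enorm_eq0 y0) dotpC -(scale0r x) dotpZl mul0r normr0//.
rewrite -(ler_pXn2r (n := 2)) ?nnegrE ?mulr_ge0 ?enorm_ge0//.
rewrite exprMn !sqr_enorm -normrX ger0_norm ?sqr_ge0//.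
have yy : 0 < dotp y y by rewrite -sqr_enorm exprn_gt0// lt0r y0 enorm_ge0.
have := dotp_ge0 (dotp y y *: x - dotp x y *: y).
rewrite dotpBl !dotpZl ![dotp _ (_ - _)]dotpC !dotpBl !dotpZl (dotpC y x).
set a := dotp x x; set b := dotp y y in yy *; set c := dotp x y => h.
have : 0 <= b * (a * b - c ^+ 2) by lra.
by rewrite pmulr_rge0// subr_ge0.
Qed.

Lemma enormD x y : enorm (x + y) <= enorm x + enorm y.
Proof.
rewrite -(ler_pXn2r (n := 2)) ?nnegrE ?addr_ge0 ?enorm_ge0//.
rewrite sqrrD !sqr_enorm dotpDl ![dotp _ (_ + _)]dotpC !dotpDl (dotpC y x).
have := le_trans (ler_norm _) (dotp_CS x y); lra.
Qed.

Lemma ler_enormB x y : enorm (x - y) <= enorm x + enorm y.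
Proof. by have := enormD x (- y); rewrite enormN. Qed.

Lemma enormB x y z : enorm (x - z) <= enorm (x - y) + enorm (y - z).
Proof. by have := enormD (x - y) (y - z); rewrite addrA subrK. Qed.

Lemma coord_le_enorm x j : `|x ord0 j| <= enorm x.
Proof.
rewrite -(ler_pXn2r (n := 2)) ?nnegrE ?enorm_ge0// sqr_enorm -normrX.
rewrite ger0_norm ?sqr_ge0// /dotp (bigD1 j)//= -expr2 lerDl.
by apply: sumr_ge0 => i _; rewrite -expr2 sqr_ge0.
Qed.

Lemma ediam_ge0 A : (0 <= ediam A)%E.
Proof. by apply: ereal_sup_ubound; left. Qed.

Lemma ediam_ub A x y : A x -> A y -> ((enorm (x - y))%:E <= ediam A)%E.
Proof. by move=> Ax Ay; apply: ereal_sup_ubound; right; exists (x, y). Qed.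

Lemma ediam_leP A r : 0 <= r ->
  (ediam A <= r%:E)%E <-> (forall x y, A x -> A y -> enorm (x - y) <= r).
Proof.
move=> r0; split=> [Ar x y Ax Ay|Ar].
  by rewrite -lee_fin; apply: le_trans Ar; exact: ediam_ub.
apply: ge_ereal_sup => _ [->|[[x y] [/= Ax Ay] <-]]; rewrite lee_fin//.
exact: Ar.
Qed.

Lemma le_ediam A B : A `<=` B -> (ediam A <= ediam B)%E.
Proof.
move=> AB; apply: ereal_sup_le => _ [->|[[x y] [/= Ax Ay] <-]]; first by left.
by right; exists (x, y) => //; split; exact: AB.
Qed.

End EuclideanNorm.

Section EuclideanTopology.
Context {R : realType} {n : nat}.
Implicit Types (x y : 'rV[R]_n.+1) (A : set 'rV[R]_n.+1).

Lemma norm_le_enorm x : `|x| <= enorm x.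
Proof.
rewrite [X in X <= _]/Num.Def.normr/= mx_normrE.
apply/bigmax_leP; split=> [|[i j] _ /=]; first exact: enorm_ge0.
by rewrite ord1; exact: coord_le_enorm.
Qed.

Lemma coord_le_norm x j : `|x ord0 j| <= `|x|.
Proof.
rewrite [X in _ <= X]/Num.Def.normr/= mx_normrE.
by apply: (le_bigmax_cond _ (fun i => `|x i.1 i.2|) (isT : xpredT (ord0, j))).
Qed.

Lemma enorm_le_norm x : enorm x <= n.+1%:R * `|x|.
Proof.
rewrite -(ler_pXn2r (n := 2)) ?nnegrE ?mulr_ge0 ?enorm_ge0 ?normr_ge0 ?ler0n//.
rewrite sqr_enorm exprMn.
apply: (@le_trans _ _ (\sum_(j < n.+1) `|x| ^+ 2)).
  apply: ler_sum => j _; rewrite -expr2 -[leLHS]ger0_norm ?sqr_ge0// normrX.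
  by rewrite lerXn2r ?nnegrE ?normr_ge0// coord_le_norm.
rewrite sumr_const card_ord -[leLHS]mulr_natl ler_wpM2r ?sqr_ge0//.
by rewrite -natrX ler_nat expnS expn1 leq_pmulr.
Qed.

Lemma open_enorm_lt x e : open [set y | enorm (x - y) < e].
Proof.
rewrite openE => y /= xy.
have d0 : 0 < (e - enorm (x - y)) / n.+2%:R by rewrite divr_gt0 ?subr_gt0 ?ltr0n.
apply/nbhs_ballP; exists ((e - enorm (x - y)) / n.+2%:R) => //= z; rewrite -ball_normE /= => yz.
apply: (le_lt_trans (enormB _ y _)); rewrite -ltrBrDl.
apply: (le_lt_trans (enorm_le_norm _)).
apply: (@le_lt_trans _ _ (n.+2%:R * `|y - z|)); first by rewrite ler_wpM2r ?ler_nat.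
by rewrite mulrC -ltr_pdivlMr ?ltr0n.
Qed.

Lemma bounded_enorm A : bounded_set A ->
  exists2 D : R, 0 < D & forall x, A x -> enorm x <= D.
Proof.
case=> M [_ /(_ (`|M| + 1))]; rewrite (le_lt_trans (ler_norm _)) ?ltrDl//.
move=> /(_ isT) h; exists (n.+1%:R * (`|M| + 1)); first by rewrite mulr_gt0// ltr_wpDl.
by move=> x /h xM; apply: (le_trans (enorm_le_norm _)); rewrite ler_wpM2l.
Qed.

Lemma closed_far (K : set 'rV[R]_n.+1) x :
  closed K -> ~ K x -> exists2 e, 0 < e & forall y, K y -> e <= enorm (x - y).
Proof.
move=> cK nKx; have := closed_openC cK; rewrite openE => /(_ _ nKx).
move=> /nbhs_ballP[e /= e0 h]; exists e => // y Ky.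
rewrite leNgt; apply/negP => xy; apply: (h y _ Ky).
by rewrite -ball_normE /=; apply: le_lt_trans xy; exact: norm_le_enorm.
Qed.

End EuclideanTopology.

(** * Words *)

Section Kraft.
Context {R : realType} {l : nat}.
Variable p : 'I_l -> R.

Definition weight (w : seq 'I_l) : R := \prod_(i <- w) p i.

Lemma weight_nil : weight [::] = 1.
Proof. by rewrite /weight big_nil. Qed.

Lemma weight_cons i w : weight (i :: w) = p i * weight w.
Proof. by rewrite /weight big_cons. Qed.

Hypothesis p_ge0 : forall i, 0 <= p i.

Lemma weight_ge0 w : 0 <= weight w.
Proof. exact: prodr_ge0. Qed.

Hypothesis sum_p : 1 <= \sum_i p i.

(** By induction on the length of the branches: the words of [A] are sorted by
    their first letter. *)
Lemma kraft m (A : seq (seq 'I_l)) :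
  (forall b, size b = m -> has (fun a => prefix a b) A) -> 1 <= \sum_(a <- A) weight a.
Proof.
elim: m A => [|m IH] A hA.
  have /hasP[[|i a] aA //= _] := hA [::] erefl.
  rewrite (perm_big _ (perm_to_rem aA))/= big_cons weight_nil lerDl.
  by apply: sumr_ge0 => w _; exact: weight_ge0.
have [nA|nA] := boolP ([::] \in A).
  rewrite (perm_big _ (perm_to_rem nA))/= big_cons weight_nil lerDl.
  by apply: sumr_ge0 => w _; exact: weight_ge0.
pose B i := [seq behead a | a <- A & ohead a == Some i].
have -> : \sum_(a <- A) weight a = \sum_i p i * \sum_(w <- B i) weight w.
  transitivity (\sum_(a <- A) \sum_(i | ohead a == Some i) weight a).
    apply: eq_big_seq => -[|i a] aA /=; first by rewrite aA in nA.
    by rewrite (big_pred1 i)// => j; apply/eqP/eqP => [[->]|->].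
  rewrite (exchange_big_dep xpredT)//=; apply: eq_bigr => i _.
  rewrite /B big_map big_filter mulr_sumr; apply: eq_bigr => -[|j a]//= /eqP[->].
  by rewrite weight_cons.
apply: (le_trans sum_p); apply: ler_sum => i _.
rewrite -[leLHS]mulr1 ler_wpM2l//; apply: IH => b bm.
have /hasP[[|j a] aA /=] := hA (i :: b) (congr1 S bm); first by rewrite aA in nA.
rewrite eqE => /andP[/eqP ji ab]; apply/hasP; exists a => //.
by apply/mapP; exists (j :: a) => //; rewrite mem_filter/= ji eqxx -ji.
Qed.

End Kraft.

(** Points of a ball of radius [D * r] at mutual distance at least [c * r] lie in
    different cells of a grid of mesh [c * r]; the number of cells meeting the
    ball depends on [c] and [D] only. *)
Lemma packing {R : realType} {n : nat} (c D : R) : 0 < c -> 0 <= D ->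
  exists N : nat, forall (T : eqType) (s : seq T) (p : T -> 'rV[R]_n.+1) u r,
    0 < r -> uniq s -> (forall a, a \in s -> enorm (p a - u) <= D * r) ->
    (forall a b, a \in s -> b \in s -> a != b -> c * r <= `|p a - p b|) ->
    (size s <= N)%N.
Proof.
move=> c0 D0; pose M := Num.truncn (2 * D / c).
exists #|{ffun 'I_n.+1 -> 'I_M.+1}| => T s p u r r0 us sD sc.
have cr : 0 < c * r by rewrite mulr_gt0.
pose q a j := ((p a - u) ord0 j + D * r) / (c * r).
have q0 a j : a \in s -> 0 <= q a j <= 2 * D / c.
  move=> /sD sa; have := le_trans (coord_le_enorm (p a - u) j) sa.
  rewrite ler_norml => /andP[h1 h2]; apply/andP; split.
    by rewrite divr_ge0 ?(ltW cr)// -lerBlDr sub0r.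
  rewrite ler_pdivrMr// (_ : _ * (c * r) = 2 * D * r); last by field; rewrite gt_eqF.
  lra.
pose f a : {ffun 'I_n.+1 -> 'I_M.+1} := [ffun j => inord (Num.truncn (q a j))].
have finj : {in s &, injective f}.
  move=> a b sa sb fab; apply/eqP/negPn/negP => ab.
  have := sc _ _ sa sb ab; rewrite leNgt => /negP; apply.
  rewrite [X in X < _]/Num.Def.normr/= mx_normrE.
  apply/bigmax_ltP; split=> // -[i j] _ /=; rewrite ord1 {i}.
  have /(congr1 (fun g : {ffun _ -> _} => val (g j))) := fab.
  rewrite !ffunE /= => h.
  have /andP[a0 a1] := q0 a j sa; have /andP[b0 b1] := q0 b j sb.
  move: h; rewrite !inordK ?ltnS; try by apply: le_truncn.
  move=> h; have /andP[h1 h2] := truncn_itv a0; have /andP[h3 h4] := truncn_itv b0.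
  rewrite h in h1 h2.
  have dq : `|q a j - q b j| < 1 by move: h2 h4; rewrite -natr1 ltr_norml; lra.
  rewrite (_ : (p a - p b) ord0 j = (q a j - q b j) * (c * r)); last first.
    by rewrite /q !mxE; field; rewrite !gt_eqF.
  by rewrite normrM (gtr0_norm cr) -[ltRHS]mul1r ltr_pM2r.
rewrite -(size_map f) -(card_uniqP _); first exact: max_card.
by rewrite map_inj_in_uniq.
Qed.

Section Words.
Context {R : realType} {n l : nat}.
Variables (lam : 'I_l -> R) (d : 'I_l -> 'rV[R]_n.+1).
Hypothesis hlam : forall i, 0 < lam i < 1.
Local Notation S := (simil lam d).
Local Notation wl := (weight lam).

Definition wmap (w : seq 'I_l) (x : 'rV[R]_n.+1) := foldr S x w.

Lemma wl_gt0 w : 0 < wl w.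
Proof. by apply: prodr_gt0 => i _; have /andP[] := hlam i. Qed.

Lemma wmapB w x y : wmap w x - wmap w y = wl w *: (x - y).
Proof.
elim: w => [|i w IH] /=; first by rewrite weight_nil scale1r.
by rewrite weight_cons /simil opprD addrACA subrr addr0 -scalerBr IH scalerA.
Qed.

Lemma enorm_wmapB w x y : enorm (wmap w x - wmap w y) = wl w * enorm (x - y).
Proof. by rewrite wmapB enormZ gtr0_norm ?wl_gt0. Qed.

Lemma wmap_inj w : injective (wmap w).
Proof.
move=> x y /eqP; rewrite -subr_eq0 wmapB scaler_eq0 gt_eqF ?wl_gt0//= subr_eq0.
by move/eqP.
Qed.

Lemma lam_bounds : exists lm lM : R,
  [/\ 0 < lm <= 1, lM < 1, 0 <= lM & forall i, lm <= lam i <= lM].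
Proof.
exists (\big[Num.min/1]_i lam i), (\big[Num.max/0]_i lam i); split.
- rewrite bigmin_le_id andbT.
  by apply/bigmin_gtP; split => // i _; have /andP[] := hlam i.
- by apply/bigmax_ltP; split => // i _; have /andP[] := hlam i.
- exact: bigmax_ge_id.
- by move=> i; rewrite bigmin_le le_bigmax.
Qed.

(** The words at which the contraction ratio first drops to [r]; the fuel [k]
    bounds their length. *)
Fixpoint cutset (k : nat) (r : R) : seq (seq 'I_l) :=
  if k is k'.+1 then
    if 1 <= r then [:: [::]] else
    flatten [seq [seq i :: w | w <- cutset k' (r / lam i)] | i <- enum 'I_l]
  else [:: [::]].

Lemma cutset_cons k r i w : i :: w \in cutset k.+1 r -> w \in cutset k (r / lam i).
Proof.
rewrite /=; case: ifP => // _ /flattenP[_ /mapP[j _ ->]] /mapP[w' h [-> ->]] //.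
Qed.

Lemma cutset_nil k r : [::] \in cutset k.+1 r -> cutset k.+1 r = [:: [::]].
Proof. by rewrite /=; case: ifP => // _ /flattenP[_ /mapP[i _ ->]] /mapP[]. Qed.

Lemma cutset_ratio lm lM k r w : (forall i, lm <= lam i <= lM) -> 0 < lm -> lM < 1 ->
  0 <= lM -> lM ^+ k <= r -> lm * r <= 1 -> w \in cutset k r ->
  lm * r <= wl w <= r.
Proof.
move=> hl lm0 lM1 lM0; elim: k r w => [|k IH] r w /=.
  by rewrite expr0 => r1 lr; rewrite inE => /eqP ->; rewrite weight_nil lr r1.
move=> kr lr; case: ifPn => [r1|].
  by rewrite inE => /eqP ->; rewrite weight_nil lr r1.
rewrite -ltNge => r1 /flattenP[_ /mapP[i _ ->]] /mapP[w' wk ->].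
have /andP[l0 _] := hlam i; have /andP[li iM] := hl i.
have r0 : 0 <= r by apply: le_trans kr; exact: exprn_ge0.
have /andP[h1 h2] : lm * (r / lam i) <= wl w' <= r / lam i.
  apply: IH => //.
  - rewrite ler_pdivlMr//; apply: le_trans kr; rewrite exprSr.
    by rewrite ler_wpM2l// exprn_ge0.
  - rewrite mulrA ler_pdivrMr// mul1r; apply: le_trans li.
    by rewrite ler_piMr// ltW.
rewrite weight_cons [lam i * _]mulrC; apply/andP; split.
  by move: h1; rewrite mulrA ler_pdivrMr.
by rewrite -ler_pdivlMr.
Qed.

Lemma cutset_prefix k r b : (k <= size b)%N -> has (fun a => prefix a b) (cutset k r).
Proof.
elim: k r b => [|k IH] r [|i b]//= kb; case: ifP => //= _.
have /hasP[w wk wb] := IH (r / lam i) b kb.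
apply/hasP; exists (i :: w); last by rewrite /= eqE/= eqxx.
apply/flattenP; exists [seq i :: w | w <- cutset k (r / lam i)].
  by apply/mapP; exists i => //; rewrite mem_enum.
by apply/mapP; exists w.
Qed.

Section OpenSet.
Variable V : set 'rV[R]_n.+1.
Hypotheses (VS : forall i, S i @` V `<=` V)
  (Vdisj : trivIset [set: 'I_l] (fun i => S i @` V)).

Lemma wmap_open_sub w : wmap w @` V `<=` V.
Proof.
elim: w => [|i w IH] x /=; first by case=> y Vy <-.
by case=> y Vy <-; apply: (VS (i := i)); exists (wmap w y) => //; apply: IH; exists y.
Qed.

(** Two words of a cutset differ at some letter, where the condition on [V]
    separates them. *)
Lemma cutset_disj k r a b : a \in cutset k r -> b \in cutset k r -> a != b ->
  wmap a @` V `&` wmap b @` V = set0.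
Proof.
elim: k r a b => [|k IH] r a b; first by rewrite !inE => /eqP-> /eqP->; rewrite eqxx.
case: a => [|i a]; case: b => [|j b] //.
- by move=> ha hb; move: hb; rewrite (cutset_nil ha) !inE.
- by move=> ha hb; move: ha; rewrite (cutset_nil hb) !inE.
move=> /cutset_cons ha /cutset_cons hb ab; apply/seteqP; split => // x [].
move=> [y Vy /= <-] [z Vz /= zy].
have [ij|ij] := eqVneq i j; last first.
  move/trivIsetP : Vdisj => /(_ i j I I ij) /seteqP[+ _].
  move=> /(_ (S i (wmap a y))); apply; split.
    by exists (wmap a y) => //; apply: wmap_open_sub; exists y.
  by exists (wmap b z) => //; apply: wmap_open_sub; exists z.
rewrite -{}ij in hb ab zy; have {}ab : a != b.
  by apply: contra ab => /eqP ->.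
have /seteqP[+ _] := IH _ _ _ ha hb ab; move=> /(_ (wmap a y)); apply.
split; first by exists y.
exists z => //; have := @wmap_inj [:: i] (wmap b z) (wmap a y); exact.
Qed.

End OpenSet.

(** A set of diameter at most [r] meets boundedly many pieces of size about [r]:
    their copies of [V] are disjoint and contain balls of radius about [r]. *)
Lemma cutset_count (F : set 'rV[R]_n.+1) lm lM : open_set_condition lam d ->
  bounded_set F -> (forall i, lm <= lam i <= lM) -> 0 < lm -> lM < 1 -> 0 <= lM ->
  exists N : nat, forall k r (U : set 'rV[R]_n.+1), 0 < r -> lM ^+ k <= r ->
    lm * r <= 1 -> (forall x y, U x -> U y -> enorm (x - y) <= r) ->
    (size (undup [seq w <- cutset k r | `[< wmap w @` F `&` U !=set0 >]]) <= N)%N.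
Proof.
move=> [V [[v Vv] oV VS Vdisj]] bF hl lm0 lM1 lM0.
have {}VS i : S i @` V `<=` V by move=> x h; apply: VS; exists i.
have [rho rho0 Vrho] : exists2 rho : R, 0 < rho & ball v rho `<=` V.
  move: oV; rewrite openE => /(_ _ Vv) /nbhs_ballP[rho /= rho0 h].
  by exists rho.
have [D D0 FD] : exists2 D : R, 0 <= D & forall x, F x -> enorm (v - x) <= D.
  have [D D0 FD] := bounded_enorm bF; exists (enorm v + D).
    by rewrite addr_ge0 ?enorm_ge0// ltW.
  by move=> x /FD xD; apply: (le_trans (ler_enormB _ _)); rewrite lerD2l.
have c0 : 0 < rho * lm by rewrite mulr_gt0.
have D1 : 0 <= D + 1 by rewrite addr_ge0.
have [N HN] := @packing R n _ _ c0 D1.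
exists N => k r U r0 kr lr Ur; set s := undup _.
have [[u Uu]|U0] := pselect (exists u, U u); last first.
  rewrite (_ : s = [::])//; apply/eqP; rewrite -size_eq0 /s.
  rewrite (@eq_in_filter _ _ pred0) ?filter_pred0// => w _ /=.
  by apply/asboolP => -[x [_ Ux]]; apply: U0; exists x.
apply: (HN _ s (wmap^~ v) u r) => //.
- exact: undup_uniq.
- move=> w; rewrite mem_undup mem_filter => /andP[/asboolP[_ [[x Fx <-] Ux]] wk].
  apply: (le_trans (enormB _ (wmap w x) _)).
  have /andP[_ wr] := cutset_ratio hl lm0 lM1 lM0 kr lr wk.
  rewrite mulrDl mul1r lerD//; last exact: Ur.
  by rewrite enorm_wmapB mulrC ler_pM ?enorm_ge0// ?FD// ltW ?wl_gt0.
- move=> a b; rewrite !mem_undup !mem_filter => /andP[_ ak] /andP[_ bk] ab.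
  rewrite leNgt; apply/negP => h.
  have /seteqP[+ _] := cutset_disj VS Vdisj ak bk ab.
  move=> /(_ (wmap b v)); apply; split; last by exists v.
  have /andP[ar _] := cutset_ratio hl lm0 lM1 lM0 kr lr ak.
  exists (v + (wl a)^-1 *: (wmap b v - wmap a v)).
    apply: Vrho; rewrite -ball_normE /= opprD addrA subrr sub0r normrN normrZ.
    rewrite ger0_norm ?invr_ge0 ?ltW ?wl_gt0// ltr_pdivrMl ?wl_gt0//.
    rewrite -normrN opprB; apply: (lt_le_trans h).
    by rewrite [leRHS]mulrC -mulrA ler_wpM2l// ltW.
  apply: (addIr (- wmap a v)); rewrite wmapB addrAC subrr add0r.
  by rewrite scalerA divff ?gt_eqF ?wl_gt0// scale1r.
Qed.

End Words.

(** * Hausdorff measures *)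

Section HausdorffBasics.
Local Open Scope ereal_scope.
Context {R : realType} {n : nat}.
Variable t : R.
Hypothesis t0 : (0 <= t)%R.
Implicit Types (A U F : set 'rV[R]_n.+1).

Lemma ediam_fin U r : ediam U <= r%:E -> ediam U \is a fin_num.
Proof.
move=> Ur; rewrite ge0_fin_numE ?ediam_ge0//.
by apply: (le_lt_trans Ur); rewrite ltry.
Qed.

Lemma hgaugeE U : U !=set0 -> ediam U \is a fin_num ->
  hgauge t U = (fine (ediam U) `^ t)%:E.
Proof.
move=> /set0P/eqP U0 Uf; rewrite /hgauge; case: asboolP => // _.
by rewrite -{1}(fineK Uf) poweR_EFin.
Qed.

Lemma hgauge_le U r : (0 <= r)%R -> ediam U <= r%:E -> hgauge t U <= (r `^ t)%:E.
Proof.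
move=> r0 Ur; have [->|/set0P U0] := eqVneq U set0.
  by rewrite hgauge0 lee_fin powR_ge0.
have Uf := ediam_fin Ur.
rewrite hgaugeE// lee_fin; apply: ge0_ler_powR => //.
- by rewrite nnegrE fine_ge0// ediam_ge0.
- by rewrite -lee_fin fineK.
Qed.

Lemma hcontentP delta A c : hcontent t delta A < c ->
  exists F : (set 'rV[R]_n.+1)^nat,
  [/\ forall k, ediam (F k) <= delta%:E, A `<=` \bigcup_k F k &
      \sum_(k <oo) hgauge t (F k) < c].
Proof. by move=> /ereal_inf_lt[_ [F [Fd AF] <-] Fc]; exists F. Qed.

Lemma hcontent_le delta A (F : (set 'rV[R]_n.+1)^nat) :
  (forall k, ediam (F k) <= delta%:E) -> A `<=` \bigcup_k F k ->
  hcontent t delta A <= \sum_(k <oo) hgauge t (F k).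
Proof. by move=> Fd AF; apply: ereal_inf_lbound; exists F. Qed.

Lemma le_hcontent delta A B : A `<=` B -> hcontent t delta A <= hcontent t delta B.
Proof.
by move=> AB; apply: ereal_inf_le_tmp => _ [F [Fd BF] <-]; exists F => //; split=> // x /AB/BF.
Qed.

Lemma hcontent_anti A d1 d2 : (d1 <= d2)%R -> hcontent t d2 A <= hcontent t d1 A.
Proof.
move=> d12; apply: ereal_inf_le_tmp => _ [F [Fd AF] <-]; exists F => //; split=> // k.
by apply: (le_trans (Fd k)); rewrite lee_fin.
Qed.

Lemma hcontent_hausdorff delta A : (0 < delta)%R -> hcontent t delta A <= hausdorff t A.
Proof. by move=> d0; apply: ereal_sup_ubound; exists delta. Qed.

Lemma hausdorff_le A c : (forall k, hcontent t k.+1%:R^-1 A <= c) -> hausdorff t A <= c.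
Proof.
move=> h; apply: ge_ereal_sup => _ [delta /= d0 <-].
have [k kd] : exists k : nat, (k.+1%:R^-1 <= delta)%R.
  exists (Num.truncn delta^-1); rewrite -[leRHS]invrK lef_pV2 ?posrE ?invr_gt0 ?ltr0n//.
  exact/ltW/truncnS_gt.
by apply: (le_trans (hcontent_anti _ kd)).
Qed.

(** An inequality suffices for scaling, as the inverse map has the same form. *)
Let hausdorff_scale_le (a : R) b A : (0 < a)%R ->
  hausdorff t ((fun x => a *: x + b)%R @` A) <= (a `^ t)%:E * hausdorff t A.
Proof.
move=> a0; have at0 : (0 < a `^ t)%R by rewrite powR_gt0.
apply: ge_ereal_sup => _ [delta /= d0 <-].
apply: (@le_trans _ _ ((a `^ t)%:E * hcontent t (delta / a) A)); last first.
  by rewrite lee_pmul2l//; apply: hcontent_hausdorff; rewrite divr_gt0.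
rewrite -lee_pdivrMl//; apply: le_ereal_inf_tmp => _ [F [Fd AF] <-].
rewrite lee_pdivrMl// -nneseriesZl; last by move=> k _; exact: hgauge_ge0.
apply: (le_trans (hcontent_le (F := fun k => (fun x => a *: x + b)%R @` F k) _ _)).
- move=> k; apply/(ediam_leP _ (ltW d0)) => _ _ [x Fx <-] [y Fy <-].
  rewrite opprD addrACA subrr addr0 -scalerBr enormZ gtr0_norm//.
  rewrite mulrC -ler_pdivlMr//.
  by have /(ediam_leP _ (ltW (divr_gt0 d0 a0))) := Fd k; exact.
- by move=> _ [x /AF[k _ Fx] <-]; exists k => //; exists x.
- apply: lee_nneseries => [k _ _|k _]; first exact: hgauge_ge0.
  have [->|F0] := eqVneq (F k) set0.
    by rewrite image_set0 hgauge0 mule0.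
  have Ff := ediam_fin (Fd k).
  rewrite [X in _ * X]hgaugeE//; last exact/set0P.
  have D0 : (0 <= fine (ediam (F k)))%R by rewrite fine_ge0// ediam_ge0.
  rewrite -EFinM -powRM ?(ltW a0)//; apply: hgauge_le; first by rewrite mulr_ge0// ltW.
  apply/ediam_leP; first by rewrite mulr_ge0// ltW.
  move=> _ _ [x Fx <-] [y Fy <-].
  rewrite opprD addrACA subrr addr0 -scalerBr enormZ gtr0_norm// ler_pM2l//.
  by rewrite -lee_fin fineK//; exact: ediam_ub.
Qed.

Lemma hausdorff_scale (a : R) b A : (0 < a)%R ->
  hausdorff t ((fun x => a *: x + b)%R @` A) = (a `^ t)%:E * hausdorff t A.
Proof.
move=> a0; apply/eqP; rewrite eq_le hausdorff_scale_le//=.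
have at0 : (0 < a `^ t)%R by rewrite powR_gt0.
have a'0 : (0 < a^-1)%R by rewrite invr_gt0.
have := @hausdorff_scale_le a^-1%R (- (a^-1 *: b))%R ((fun x => a *: x + b)%R @` A) a'0.
rewrite -(@lee_pmul2l _ (a `^ t)%:E erefl)//.
rewrite muleA -EFinM -powRM ?(ltW a0) ?(ltW a'0)// divff ?gt_eqF// powR1 mul1e.
rewrite (_ : _ @` (_ @` A) = A) // image_comp.
rewrite (_ : _ \o _ = id) ?image_id//; apply/funext => x /=.
by rewrite scalerDr scalerA mulVf ?gt_eqF// scale1r addrK.
Qed.

(** The margin is so small that the gauge grows by at most [e], by continuity of
    the power; for [t = 0] any margin will do. *)
Lemma open_enlarge F delta e : (0 < delta)%R -> (0 < e)%R -> F !=set0 ->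
  ediam F <= delta%:E -> exists U r, [/\ open U, F `<=` U, (0 < r <= 2 * delta)%R,
    (forall x y, U x -> U y -> (enorm (x - y) <= r)%R) &
    (r `^ t)%:E <= hgauge t F + e%:E].
Proof.
move=> d0 e0 F0 Fd; have Ff := ediam_fin Fd; pose D := fine (ediam F).
have D0 : (0 <= D)%R by rewrite fine_ge0// ediam_ge0.
have Dd : (D <= delta)%R by rewrite -lee_fin fineK.
have [r [Dr rd rt]] : exists r : R, [/\ (D < r)%R, (r <= 2 * delta)%R &
    (r `^ t <= D `^ t + e)%R].
  have D2 : (D < 2 * delta)%R by lra.
  have [->|tn0] := eqVneq t 0%R.
    by exists (2 * delta)%R; split=> //; rewrite !powRr0 lerDl ltW.
  have tp : (0 < t)%R by rewrite lt_neqAle eq_sym tn0.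
  exists (Num.min (2 * delta)%R ((D `^ t + e) `^ t^-1))%R; split.
  - rewrite lt_min D2/=.
    have {1}-> : D = ((D `^ t) `^ t^-1)%R by rewrite -powRrM mulfV// powRr1.
    apply: gt0_ltr_powR; rewrite ?invr_gt0// ?nnegrE ?powR_ge0//.
      by rewrite addr_ge0 ?powR_ge0// ltW.
    by rewrite ltrDl.
  - by rewrite ge_min lexx.
  - apply: (@le_trans _ _ (((D `^ t + e) `^ t^-1) `^ t)%R).
      apply: ge0_ler_powR; rewrite ?nnegrE ?powR_ge0//.
        by rewrite le_min powR_ge0 andbT mulr_ge0// ltW.
      by rewrite ge_min lexx orbT.
    rewrite -powRrM mulVf// powRr1// addr_ge0 ?powR_ge0//; exact: ltW.
have e'0 : (0 < (r - D) / 2)%R by rewrite divr_gt0// subr_gt0.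
exists (\bigcup_(x in F) [set y | enorm (x - y) < (r - D) / 2]%R), r; split.
- by apply: bigcup_open => x _; exact: open_enorm_lt.
- move=> x Fx; exists x => //=; rewrite subrr.
  by rewrite enorm0.
- by rewrite rd (le_lt_trans D0 Dr).
- move=> x y [x' Fx' /= xx'] [y' Fy' /= yy'].
  have h := enormB x x' y; have h' := enormB x' y' y.
  rewrite enormBC in xx'.
  have : (enorm (x' - y') <= D)%R by rewrite -lee_fin fineK//; exact: ediam_ub.
  lra.
- by rewrite hgaugeE// -EFinD lee_fin.
Qed.

(** The numbers [r k] are positive bounds of the diameters and may exceed them.
    The gauge of an empty set is 0, whereas [r k `^ t] is not: hence the numbers
    [v k], which agree with the latter for the nonempty members of the cover. *)
Lemma hcontent_open_cover delta A c : (0 < delta)%R -> hcontent t delta A < c ->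
  exists (U : (set 'rV[R]_n.+1)^nat) (r v : nat -> R), [/\
    forall k, [/\ open (U k), (0 < r k <= 2 * delta)%R,
      (forall x y, U k x -> U k y -> (enorm (x - y) <= r k)%R), (0 <= v k)%R &
      U k !=set0 -> v k = (r k `^ t)%R],
    A `<=` \bigcup_k U k & \sum_(k <oo) (v k)%:E < c].
Proof.
move=> d0 /hcontentP[F [Fd AF Fc]].
have [e e0 ec] : exists2 e : R, (0 < e)%R & \sum_(k <oo) hgauge t (F k) + e%:E < c.
  have S0 : 0 <= \sum_(k <oo) hgauge t (F k).
    by apply: nneseries_ge0 => k _ _; exact: hgauge_ge0.
  move: Fc S0; case: (\sum_(_ <oo) _) => [S| |]; case: c => [c| |] //.
  - rewrite lte_fin => Sc _; exists ((c - S) / 2)%R; first by rewrite divr_gt0// subr_gt0.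
    by rewrite -EFinD lte_fin; lra.
  - by exists 1%R => //; rewrite -EFinD ltry.
have H k : exists Urv : set 'rV[R]_n.+1 * R * R, let: (U, r, v) := Urv in
    [/\ [/\ open U, (0 < r <= 2 * delta)%R,
      (forall x y, U x -> U y -> (enorm (x - y) <= r)%R), (0 <= v)%R &
      U !=set0 -> v = (r `^ t)%R], F k `<=` U &
      v%:E <= hgauge t (F k) + (e / (2 ^ k.+1)%:R)%:E].
  have ek0 : (0 < e / (2 ^ k.+1)%:R)%R by rewrite divr_gt0// ltr0n expn_gt0.
  have [->|/set0P F0] := eqVneq (F k) set0.
    exists (set0, delta, 0%R); split; [split|by []|] => //.
    - by apply/andP; split=> //; lra.
    - by case.
    - by rewrite hgauge0 add0e lee_fin ltW.
  have [U [r [oU FU r0 Ur rt]]] := open_enlarge d0 ek0 F0 (Fd k).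
  by exists (U, r, r `^ t)%R; split=> //; split=> //; exact: powR_ge0.
have [f Hf] := choice H.
exists (fun k => (f k).1.1), (fun k => (f k).1.2), (fun k => (f k).2); split.
- by move=> k; move: (Hf k); case: (f k) => -[U r] v /= [].
- move=> x /AF[k _ Fx]; exists k => //.
  by move: (Hf k); case: (f k) => -[U r] v /= [_ + _]; exact.
- apply: le_lt_trans ec.
  apply: le_trans (epsilon_trick xpredT _ (ltW e0)); last by move=> k; exact: hgauge_ge0.
  apply: lee_nneseries => [k _ _|k _].
    by move: (Hf k); case: (f k) => -[U r] v /= [[]]; rewrite lee_fin.
  by move: (Hf k); case: (f k) => -[U r] v /= [].
Qed.

Lemma hcontent_compact_cover delta A c : (0 < delta)%R -> compact A ->
  hcontent t delta A < c%:E -> exists s : seq (set 'rV[R]_n.+1 * R), [/\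
    forall p, p \in s -> [/\ open p.1, (0 < p.2 <= 2 * delta)%R &
      (forall x y, p.1 x -> p.1 y -> (enorm (x - y) <= p.2)%R)],
    (forall x, A x -> exists2 p, p \in s & p.1 x) &
    (\sum_(p <- s) p.2 `^ t < c)%R].
Proof.
move=> d0 cA /(hcontent_open_cover d0)[U [r [v [HU AU vc]]]].
rewrite compact_cover in cA.
have [D _ AD] := cA nat setT U (fun k _ => let: And5 h _ _ _ _ := HU k in h) AU.
exists [seq (U k, r k) | k <- D & `[< U k !=set0 >]]; split.
- by move=> _ /mapP[k _ ->]/=; have [] := HU k.
- move=> x /AD[k kD Ux]; exists (U k, r k) => //; apply/mapP; exists k => //.
  by rewrite mem_filter kD andbT; apply/asboolP; exists x.
- rewrite big_map big_filter -lte_fin; apply: le_lt_trans vc.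
  rewrite -sumEFin.
  apply: (@le_trans _ _ (\sum_(k <- D) (v k)%:E)).
    rewrite big_mkcond/=; apply: lee_sum => k _; case: asboolP => [Uk|_].
      by have [_ _ _ _ ->] := HU k.
    by have [_ _ _ + _] := HU k; rewrite lee_fin.
  have v0 k : 0 <= (v k)%:E by have [_ _ _ + _] := HU k; rewrite lee_fin.
  rewrite nneseries_esumT// (_ : \sum_(k <- D) _ = \sum_(k \in [set` D]) (v k)%:E).
    by apply: esum_ge; exists [set` D] => //; split=> //; exact: finite_fset.
  by rewrite fsbig_finite//= set_fsetK.
Qed.

(** The regularity of the measure comes from that of the content: each nearly
    optimal cover may be taken open. *)
Lemma hausdorff_Gdelta A : exists O : (set 'rV[R]_n.+1)^nat,
  [/\ forall k, open (O k), A `<=` \bigcap_k O k &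
      hausdorff t (\bigcap_k O k) <= hausdorff t A].
Proof.
have [->|fA] := eqVneq (hausdorff t A) +oo.
  by exists (fun=> setT); split=> [k||]; [exact: openT|by []|exact: leey].
have {}fA : hausdorff t A \is a fin_num.
  by rewrite ge0_fin_numE ?outer_measure_ge0// lt_neqAle fA leey.
have H k : exists O, [/\ open O, A `<=` O &
    hcontent t (2 * k.+1%:R^-1) O <= hausdorff t A + k.+1%:R^-1%:E].
  have k0 : (0 < k.+1%:R^-1 :> R)%R by rewrite invr_gt0 ltr0n.
  have /(hcontent_open_cover k0)[U [r [v [HU AU vc]]]] :
      hcontent t k.+1%:R^-1 A < hausdorff t A + k.+1%:R^-1%:E.
    apply: (le_lt_trans (hcontent_hausdorff _ k0)).
    by rewrite -[ltLHS]adde0 lteD2lE// lte_fin.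
  exists (\bigcup_k U k); split=> //.
    by apply: bigcup_open => i _; have [] := HU i.
  apply: le_trans (ltW vc); apply: (le_trans (hcontent_le (F := U) _ _)) => //.
    move=> i; have [_ /andP[r0 r2] Ur _ _] := HU i.
    by apply/ediam_leP => [|x y Ux Uy]; [exact: le_trans (ltW r0) r2|apply: le_trans r2; exact: Ur].
  apply: lee_nneseries => [i _ _|i _]; first exact: hgauge_ge0.
  have [_ /andP[r0 r2] Ur v0 vE] := HU i.
  have [->|/set0P U0] := eqVneq (U i) set0; first by rewrite hgauge0 lee_fin.
  by rewrite vE//; apply: hgauge_le; [exact: ltW|exact/(ediam_leP _ (ltW r0))].
have [G HG] := choice H; exists G; split; first by move=> k; case: (HG k).
- by move=> x Ax k _; have [_ AG _] := HG k; exact: AG.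
- apply/lee_addgt0Pr => e e0; apply: ge_ereal_sup => _ [delta /= d0 <-].
  pose m := Num.min (delta / 2)%R e; have m0 : (0 < m)%R by rewrite lt_min e0 divr_gt0.
  pose k := Num.truncn m^-1.
  have km : (k.+1%:R^-1 <= m)%R.
    rewrite -[leRHS]invrK lef_pV2 ?posrE ?invr_gt0 ?ltr0n//.
    exact/ltW/truncnS_gt.
  have [_ _] := HG k => hk.
  apply: (@le_trans _ _ (hcontent t (2 * k.+1%:R^-1) (\bigcap_k G k))).
    by apply: hcontent_anti; move: km; rewrite /m le_min => /andP[km _]; rewrite -ler_pdivlMl// mulrC.
  apply: (@le_trans _ _ (hcontent t (2 * k.+1%:R^-1) (G k))).
    by apply: le_hcontent => x; exact.
  apply: (le_trans hk); rewrite leeD2l// lee_fin.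
  by move: km; rewrite le_min => /andP[].
Qed.

End HausdorffBasics.

(** * Outer measures *)

Section CaratheodoryMeasure.
Local Open Scope ereal_scope.
Context {R : realType} {T : pointedType}.
Variable mu : {outer_measure set T -> \bar R}.
Implicit Types (A : set T) (F : (set T)^nat).

Definition cmeasure : {measure set (caratheodory_type mu) -> \bar R} :=
  (mu : set (caratheodory_type mu) -> \bar R).

Lemma caratheodory_bigcup F :
  (forall i, mu.-caratheodory (F i)) -> mu.-caratheodory (\bigcup_i F i).
Proof. exact: caratheodory_measurable_bigcup. Qed.

Lemma caratheodory_bigcap F :
  (forall i, mu.-caratheodory (F i)) -> mu.-caratheodory (\bigcap_i F i).
Proof.
move=> mF; apply: (@bigcap_measurable _ (caratheodory_type mu)) => [|i _]; last exact: mF.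
by exists 0%N.
Qed.

Lemma caratheodory_bigcup_cvg F : (forall i, mu.-caratheodory (F i)) ->
  nondecreasing_seq F -> mu (F i) @[i --> \oo] --> mu (\bigcup_i F i).
Proof.
move=> mF ndF; apply: (@nondecreasing_cvg_mu _ _ _ cmeasure F) => //.
exact: caratheodory_bigcup.
Qed.

Lemma caratheodory_bigcap_cvg F : mu (F 0%N) < +oo ->
  (forall i, mu.-caratheodory (F i)) ->
  nonincreasing_seq F -> mu (F i) @[i --> \oo] --> mu (\bigcap_i F i).
Proof.
move=> F0 mF niF; apply: (@nonincreasing_cvg_mu _ _ _ cmeasure F) => //.
exact: caratheodory_bigcap.
Qed.

Lemma null_caratheodory A : mu A = 0 -> mu.-caratheodory A.
Proof.
move=> A0; apply: le_caratheodory_measurable => X.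
rewrite (_ : mu (X `&` A) = 0) ?add0e.
  by apply: le_outer_measure; exact: subIsetl.
apply/eqP; rewrite eq_le outer_measure_ge0 andbT -A0.
by apply: le_outer_measure; exact: subIsetr.
Qed.

End CaratheodoryMeasure.

(** * Closed sets are measurable *)

Section MetricOuterMeasure.
Local Open Scope ereal_scope.
Context {R : realType} {n : nat}.
Variable mu : {outer_measure set 'rV[R]_n.+1 -> \bar R}.
Hypothesis mu_metric : forall (A B : set 'rV[R]_n.+1) (r : R), (0 < r)%R ->
  (forall x y, A x -> B y -> (r <= enorm (x - y))%R) -> mu A + mu B <= mu (A `|` B).

(** Caratheodory's criterion. The complement of a closed set [K] is exhausted by
    the sets [far j] of points at distance at least [1 / (j + 1)] from [K]; what
    [far j] misses is a union of layers, any two of which are separated unless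
    they are consecutive, so that their measures have a finite sum. *)
Lemma closed_caratheodory K : closed K -> mu.-caratheodory K.
Proof.
move=> cK; apply: le_caratheodory_measurable => X.
have [->|Xfin] := eqVneq (mu X) +oo; first exact: leey.
have {}Xfin : mu X \is a fin_num.
  by rewrite ge0_fin_numE ?outer_measure_ge0// lt_neqAle Xfin leey.
pose far (j : nat) := [set x | forall y, K y -> (j.+1%:R^-1 <= enorm (x - y))%R].
pose layer j := X `&` (far j.+1 `\` far j).
pose near j := X `&` ~` far j.
have le_far i j : (i <= j)%N -> far i `<=` far j.
  move=> ij x Fx y Ky; apply: le_trans (Fx y Ky).
  by rewrite lef_pV2 ?posrE ?ltr0n// ler_nat ltnS.
have step j : mu (layer j) + mu (near j.+2) <= mu (near j).
  have ij : (0 < j.+2%:R^-1 - j.+3%:R^-1 :> R)%R.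
    by rewrite subr_gt0 ltf_pV2 ?posrE ?ltr0n// ltr_nat.
  apply: le_trans (mu_metric ij _) _ => [x y [_ [Fx _]]|].
    move=> [_ /existsNP[z /not_implyP[Kz /negP]]].
    rewrite -ltNge => yz; rewrite lerBlDr; apply: le_trans (Fx z Kz) _.
    by apply: le_trans (enormB x y z) _; rewrite lerD2l ltW.
  apply: le_outer_measure => x [[Xx [_ nF]]|[Xx nF]]; split => //.
  by apply: contra_not nF; apply: le_far; rewrite ltnW.
have sums N : \sum_(0 <= i < N) mu (layer i) + mu (near N) + mu (near N.+1) <=
    mu X + mu X.
  elim: N => [|N IH].
    by rewrite big_nil add0e leeD//; apply: le_outer_measure; exact: subIsetl.
  apply: le_trans IH; rewrite big_nat_recr//= -!addeA leeD2l// addeCA [leRHS]addeC.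
  by rewrite leeD2l//; exact: step.
have layer0 k : 0 <= mu (layer k) by exact: outer_measure_ge0.
have summable : \sum_(i <oo) mu (layer i) < +oo.
  apply: (@le_lt_trans _ _ (mu X + mu X)).
    apply: lime_le; first by apply: is_cvg_nneseries => *; exact: layer0.
    apply: nearW => N; apply: le_trans (sums N).
    by rewrite -addeA leeDl// adde_ge0// outer_measure_ge0.
  by rewrite ltey_eq fin_numD Xfin.
have KN N : mu (X `&` K) + mu (X `&` far N) <= mu X.
  have N0 : (0 < N.+1%:R^-1 :> R)%R by rewrite invr_gt0 ltr0n.
  apply: le_trans (mu_metric N0 _) _ => [x y [_ Kx] [_ Fy]|].
    by rewrite enormBC; exact: Fy.
  by apply: le_outer_measure => x [[]|[]].
have NKN N : mu (X `&` ~` K) <= mu (X `&` far N) + \sum_(N <= i <oo) mu (layer i).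
  apply: (@le_trans _ _ (mu ((X `&` far N) `|` \bigcup_(i in ~` `I_N) layer i))).
    apply: le_outer_measure => x [Xx nKx].
    have [j Fj] : exists j, far j x.
      have [e e0 h] := closed_far cK nKx; exists (Num.truncn e^-1) => y Ky.
      apply: (le_trans _ (h y Ky)).
      rewrite -[leRHS]invrK lef_pV2 ?posrE ?invr_gt0 ?ltr0n//.
      exact/ltW/truncnS_gt.
    have [xN|xN] := pselect (far N x); [by left|right].
    elim: j Fj => [|j IH] Fj; first by case: xN; exact: le_far Fj.
    have [/IH//|nFj] := pselect (far j x).
    exists j => //= jN; apply: xN; exact: le_far Fj.
  apply: (le_trans (outer_measureU2 _ _ _)); rewrite leeD2l//.
  exact: outer_measure_sigma_subadditive_tail.
have tail := nneseries_tail_cvg summable (fun k _ => layer0 k).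
have lim : (fun N => mu X + \sum_(N <= i <oo) mu (layer i)) @ \oo --> mu X + 0.
  by apply: cvgeD => //; [rewrite fin_num_adde_defl|exact: cvg_cst].
rewrite -[leRHS]adde0; apply: (cvge_to_ge lim); apply: nearW => N.
apply: (le_trans (leeD2l _ (NKN N))); rewrite addeA leeD2r//.
Qed.

End MetricOuterMeasure.

Section HausdorffMetric.
Local Open Scope ereal_scope.
Context {R : realType} {n : nat}.
Variable t : R.

(** A set of diameter less than [r] meets at most one of [A] and [B], so that a fine
    cover of the union splits into a cover of [A] and one of [B]. *)
Lemma hausdorff_metric (A B : set 'rV[R]_n.+1) (r : R) : (0 < r)%R ->
  (forall x y, A x -> B y -> (r <= enorm (x - y))%R) ->
  hausdorff t A + hausdorff t B <= hausdorff t (A `|` B).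
Proof.
move=> r0 AB.
have h delta : (0 < delta)%R -> (delta < r)%R ->
    hcontent t delta A + hcontent t delta B <= hausdorff t (A `|` B).
  move=> d0 dr; apply: le_trans (hcontent_hausdorff _ _ d0).
  apply: le_ereal_inf_tmp => _ [F [Fd ABF] <-].
  pose FA k := if `[< F k `&` A !=set0 >] then F k else set0.
  pose FB k := if `[< F k `&` B !=set0 >] then F k else set0.
  have d0' := ltW d0.
  apply: (@le_trans _ _ (\sum_(k <oo) hgauge t (FA k) + \sum_(k <oo) hgauge t (FB k))).
    apply: leeD; apply: hcontent_le.
    - by move=> k; rewrite /FA; case: ifP => // _; rewrite ediam0 lee_fin.
    - move=> x Ax; have [k _ Fx] := ABF x (or_introl Ax); exists k => //.
      by rewrite /FA; case: asboolP => // -[]; exists x.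
    - by move=> k; rewrite /FB; case: ifP => // _; rewrite ediam0 lee_fin.
    - move=> x Bx; have [k _ Fx] := ABF x (or_intror Bx); exists k => //.
      by rewrite /FB; case: asboolP => // -[]; exists x.
  rewrite -nneseriesD; try by move=> k _ _; exact: hgauge_ge0.
  apply: lee_nneseries => [k _ _|k _]; first by rewrite adde_ge0 ?hgauge_ge0.
  rewrite /FA /FB; case: asboolP => [[x [Fx Ax]]|_]; last first.
    by rewrite hgauge0 add0e; case: ifP => // _; rewrite hgauge0 hgauge_ge0.
  case: asboolP => [[y [Fy By]]|_]; last by rewrite hgauge0 adde0.
  have := AB _ _ Ax By; rewrite leNgt => /negP; case.
  apply: le_lt_trans dr.
  by have /(ediam_leP _ d0') := Fd k; exact.
set M := hausdorff t (A `|` B) in h *.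
have [->|MNy] := eqVneq M +oo; first exact: leey.
have Mf : M \is a fin_num.
  by rewrite ge0_fin_numE ?outer_measure_ge0// lt_neqAle MNy leey.
have {}h d1 d2 : (0 < d1)%R -> (0 < d2)%R ->
    hcontent t d1 A + hcontent t d2 B <= M.
  move=> d10 d20; pose m := Num.min (r / 2)%R (Num.min d1 d2).
  have m0 : (0 < m)%R by rewrite !lt_min d10 d20 divr_gt0.
  have mr : (m < r)%R.
    by rewrite gt_min ltr_pdivrMr// mulr_natr mulr2n ltrDl r0.
  apply: le_trans (h m m0 mr); rewrite leeD//; apply: hcontent_anti.
    by rewrite !ge_min lexx orbT.
  by rewrite !ge_min lexx !orbT.
have fB d2 : (0 < d2)%R -> hcontent t d2 B \is a fin_num.
  move=> d20; rewrite ge0_fin_numE ?hcontent_ge0//.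
  apply: (le_lt_trans (leeDr _ (hcontent_ge0 t 1 A))).
  by apply: (le_lt_trans (h _ _ ltr01 d20)); rewrite ltey_eq Mf.
have hA d2 : (0 < d2)%R -> hausdorff t A + hcontent t d2 B <= M.
  move=> d20; rewrite -leeBrDr ?fB//; apply: ge_ereal_sup => _ [d1 /= d10 <-].
  by rewrite leeBrDr ?fB//; exact: h.
have fA : hausdorff t A \is a fin_num.
  rewrite ge0_fin_numE ?outer_measure_ge0//.
  apply: (le_lt_trans (leeDl _ (hcontent_ge0 t 1 B))).
  by apply: (le_lt_trans (hA _ ltr01)); rewrite ltey_eq Mf.
rewrite addeC -leeBrDr//; apply: ge_ereal_sup => _ [d2 /= d20 <-].
by rewrite leeBrDr// addeC; exact: hA.
Qed.

Lemma hausdorff_closed (K : set 'rV[R]_n.+1) : closed K ->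
  (hausdorff t).-caratheodory K.
Proof. by move=> cK; apply: closed_caratheodory => // A B r; exact: hausdorff_metric. Qed.

End HausdorffMetric.

(** * Dimension of a self-similar set *)

Section DimensionMonotone.
Local Open Scope ereal_scope.
Context {R : realType} {n : nat}.

Lemma hausdorff_dim_ge0 (A : set 'rV[R]_n) : 0 <= hausdorff_dim A.
Proof. by apply: le_ereal_inf_tmp => _ [u [u0 _] <-]; rewrite lee_fin. Qed.

(** A diameter below 1 has smaller powers for larger exponents. *)
Lemma hausdorff_eq0 (u t : R) (A : set 'rV[R]_n.+1) : (0 <= u <= t)%R ->
  hausdorff u A = 0 -> hausdorff t A = 0.
Proof.
move=> /andP[u0 ut] A0; have t0 := le_trans u0 ut.
apply/eqP; rewrite eq_le outer_measure_ge0 andbT -[leRHS]A0.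
apply: hausdorff_le => k; have k0 : (0 < k.+1%:R^-1 :> R)%R by rewrite invr_gt0 ltr0n.
apply: le_trans (hcontent_hausdorff _ _ k0).
apply: le_ereal_inf_tmp => _ [F [Fd AF] <-]; apply: (le_trans (hcontent_le t Fd AF)).
apply: lee_nneseries => [i _ _|i _]; first exact: hgauge_ge0.
have [->|/set0P F0] := eqVneq (F i) set0; first by rewrite !hgauge0.
have Ff := ediam_fin (Fd i); rewrite !hgaugeE// lee_fin.
set D := fine _; have D0 : (0 <= D)%R by rewrite fine_ge0// ediam_ge0.
have D1 : (D <= 1)%R.
  rewrite -lee_fin fineK//; apply: (le_trans (Fd i)).
  by rewrite lee_fin invf_le1 ?ltr0n// ler1n.
move: D0; rewrite le_eqVlt => /predU1P[<-|D0].
  have [t0'|tn0] := eqVneq t 0%R; last by rewrite (powR0 tn0) powR_ge0.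
  by have -> : t = u by apply/eqP; rewrite eq_le ut t0' u0.
by apply: ger_powR => //; rewrite D0.
Qed.

Lemma hausdorff_dim_gt0 (s t : R) (A : set 'rV[R]_n.+1) :
  hausdorff_dim A = s%:E -> (s < t)%R -> hausdorff t A = 0.
Proof.
move=> As st; have : hausdorff_dim A < t%:E by rewrite As lte_fin.
move=> /ereal_inf_lt[_ [u [u0 Au] <-]]; rewrite lte_fin => ut.
by apply: (hausdorff_eq0 (u := u)); rewrite ?u0 ?ltW.
Qed.

End DimensionMonotone.

Lemma outer_measure_seq {R : realType} {T : Type} {I : eqType}
    (mu : {outer_measure set T -> \bar R}) (r : seq I) (F : I -> set T) (A : set T) :
  (forall x, A x -> exists2 i, i \in r & F i x) ->
  (mu A <= \sum_(i <- r) mu (F i))%E.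
Proof.
elim: r A => [|i r IH] A AF.
  rewrite big_nil (_ : A = set0) ?outer_measure0//.
  by apply/seteqP; split=> // x /AF[].
rewrite big_cons; apply: (@le_trans _ _ (mu (F i) + mu (A `\` F i))%E).
  apply: le_trans (outer_measureU2 _ _ _); apply: le_outer_measure => x Ax.
  by have [Fx|Fx] := pselect (F i x); [left|right].
rewrite leeD2l//; apply: IH => x [/AF[j + Fj] nFi].
by rewrite inE => /predU1P[ji|jr]; [rewrite ji in Fj|exists j].
Qed.

Lemma expr_le_seq {R : realType} (a : R) (s : seq R) : 0 <= a < 1 ->
  (forall r, r \in s -> 0 < r) -> exists k : nat, forall r, r \in s -> a ^+ k <= r.
Proof.
move=> /andP[a0 a1] s0.
have r0 : 0 < \big[Num.min/1]_(r <- s) r.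
  by rewrite big_seq; elim/big_ind : _ => // x y x0 y0; rewrite lt_min x0.
have cvg : a ^+ k @[k --> \oo] --> 0 by apply: cvg_expr; rewrite ger0_norm.
have /cvgr0Pnorm_lt/(_ _ r0)[k _ /(_ k (leqnn k)) /= h] := cvg.
exists k => r rs; move: h; rewrite ger0_norm ?exprn_ge0// => /ltW /le_trans; apply.
exact: ge_bigmin_seq.
Qed.

Section SelfSimilar.
Context {R : realType} {n l : nat}.
Variables (lam : 'I_l -> R) (d : 'I_l -> 'rV[R]_n.+1) (E : set 'rV[R]_n.+1).
Hypothesis hlam : forall i, 0 < lam i < 1.
Hypothesis hE : is_attractor lam d E.
Local Notation S := (simil lam d).
Local Notation wl := (weight lam).
Local Notation wm := (wmap lam d).

Lemma attractor_sub w x : E x -> E (wm w x).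
Proof.
move=> Ex; elim: w => //= i w IH; have [_ _ ->] := hE.
by exists i => //; exists (wm w x).
Qed.

Lemma wmap_cat w w' x : wm (w ++ w') x = wm w (wm w' x).
Proof. by rewrite /wmap foldr_cat. Qed.

Lemma wmap_affine w x : wm w x = wl w *: x + wm w 0.
Proof. by rewrite -[LHS](subrK (wm w 0)) wmapB// subr0. Qed.

Lemma hausdorff_wmap t w A : 0 <= t ->
  (hausdorff t (wm w @` A) = (wl w `^ t)%:E * hausdorff t A)%E.
Proof.
move=> t0; rewrite -(hausdorff_scale t0 (wm w 0) A (wl_gt0 hlam w)).
by congr hausdorff; apply: eq_imagel => x _; exact: wmap_affine.
Qed.

Lemma weight_powR t w : weight (fun i => lam i `^ t) w = wl w `^ t.
Proof.
elim: w => [|i w IH]; first by rewrite !weight_nil powR1.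
by rewrite !weight_cons IH powRM// ?(ltW (wl_gt0 hlam _))//; case/andP: (hlam i) => /ltW.
Qed.

Fixpoint words (m : nat) : seq (seq 'I_l) :=
  if m is m'.+1 then [seq i :: w | i <- enum 'I_l, w <- words m'] else [:: [::]].

Lemma size_words m w : w \in words m -> size w = m.
Proof.
elim: m w => [|m IH] w /=; first by rewrite inE => /eqP ->.
by move=> /allpairsP[[i v] [_ /= vm ->]] /=; rewrite IH.
Qed.

Lemma attractor_words m x : E x -> exists2 w, w \in words m & (wm w @` E) x.
Proof.
elim: m x => [|m IH] x; first by exists [::]; [rewrite inE|exists x].
have [_ _ {1}->] := hE; move=> [i _ [y Ey <-]].
have [w wm' [z Ez <-]] := IH y Ey; exists (i :: w); last by exists z.
by apply/allpairsP; exists (i, w); rewrite mem_enum.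
Qed.

Lemma sum_words (p : 'I_l -> R) m :
  \sum_(w <- words m) weight p w = (\sum_i p i) ^+ m.
Proof.
elim: m => [|m IH]; first by rewrite big_seq1 weight_nil expr0.
rewrite [words _]/= big_allpairs_dep exprS mulr_suml big_enum/=.
apply: eq_bigr => i _; rewrite -IH mulr_sumr; apply: eq_bigr => w _.
by rewrite weight_cons.
Qed.

(** The mass distribution principle, with Kraft's inequality in place of a
    self-similar measure: each member of a finite cover of [E] is charged with
    the boundedly many pieces of its own size which it meets. *)
Lemma hausdorff_gt0 (p : 'I_l -> R) t : open_set_condition lam d -> 0 <= t ->
  (forall i, 0 <= p i <= lam i `^ t) -> 1 <= \sum_i p i -> (0 < hausdorff t E)%E.
Proof.
move=> hosc t0 hp sp; have [[e Ee] cE _] := hE.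
have [lm [lM [/andP[lm0 lm1] lM1 lM0 hl]]] := lam_bounds hlam.
have [N HN] := cutset_count hlam hosc (compact_bounded cE) hl lm0 lM1 lM0.
have c0 : 0 < N.+1%:R^-1 :> R by rewrite invr_gt0 ltr0n.
apply: (@lt_le_trans _ _ (N.+1%:R^-1)%:E); first by rewrite lte_fin.
(* open covers of mesh 1/2 have members of diameter at most 1 *)
have h0 : 0 < 2^-1 :> R by rewrite invr_gt0.
apply: le_trans (hcontent_hausdorff t _ h0); rewrite leNgt; apply/negP.
move=> /(hcontent_compact_cover t0 h0 cE)[s [Hs Es sc]].
have [k Hk] : exists k : nat, forall q, q \in s -> lM ^+ k <= q.2.
  have [||k Hk] := @expr_le_seq R lM [seq q.2 | q <- s]; first by rewrite lM0.
    by move=> _ /mapP[q /Hs[_ /andP[q0 _] _] ->].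
  by exists k => q qs; apply: Hk; apply/mapP; exists q.
pose W (q : set 'rV[R]_n.+1 * R) := undup [seq w <- cutset lam k q.2 | `[< wm w @` E `&` q.1 !=set0 >]].
have : 1 <= \sum_(a <- flatten [seq W q | q <- s]) weight p a.
  apply: (kraft (fun i => (andP (hp i)).1) sp (m := k)) => b bk.
  have [q qs qb] := Es _ (attractor_sub b Ee).
  have /hasP[w wk /prefixP[b' bE]] := @cutset_prefix _ _ lam k q.2 b (eq_leq (esym bk)).
  apply/hasP; exists w; last by apply/prefixP; exists b'.
  apply/flattenP; exists (W q); first by apply/mapP; exists q.
  rewrite mem_undup mem_filter wk andbT; apply/asboolP; exists (wm b e); split=> //.
  by exists (wm b' e); [exact: attractor_sub|rewrite bE wmap_cat].
rewrite big_flatten big_map/= leNgt => /negP; apply.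
apply: (@le_lt_trans _ _ (N%:R * \sum_(q <- s) q.2 `^ t)); last first.
  apply: (@le_lt_trans _ _ (N.+1%:R * \sum_(q <- s) q.2 `^ t)).
    by rewrite ler_wpM2r ?ler_nat// sumr_ge0// => q _; exact: powR_ge0.
  by rewrite mulrC -ltr_pdivlMr ?ltr0n// mul1r.
rewrite mulr_sumr big_seq [leRHS]big_seq; apply: ler_sum => q qs.
have [_ /andP[q0 q1] Uq] := Hs _ qs.
have {}q1 : q.2 <= 1 by apply: le_trans q1 _; rewrite mulfV.
have lq : lm * q.2 <= 1 by rewrite mulr_ile1// ltW.
apply: (@le_trans _ _ (\sum_(w <- W q) q.2 `^ t)).
  rewrite big_seq [leRHS]big_seq; apply: ler_sum => w.
  rewrite mem_undup mem_filter => /andP[_ wk].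
  have /andP[_ wr] := cutset_ratio hlam hl lm0 lM1 lM0 (Hk _ qs) lq wk.
  apply: (@le_trans _ _ (wl w `^ t)).
    rewrite -weight_powR; apply: ler_prod => i _; exact: hp.
  by apply: ge0_ler_powR => //; rewrite nnegrE ltW// wl_gt0.
rewrite big_const_seq count_predT iter_addr_0 -[leLHS]mulr_natl ler_wpM2r ?powR_ge0// ler_nat.
exact: (HN k q.2 q.1 q0 (Hk _ qs) lq Uq).
Qed.

Section Dimension.
Variable s : R.
Hypotheses (hosc : open_set_condition lam d) (hs : hausdorff_dim E = s%:E)
  (Epos : (0 < hausdorff s E)%E) (Efin : (hausdorff s E < +oo)%E).

Let s0 : 0 <= s.
Proof. by rewrite -lee_fin -hs hausdorff_dim_ge0. Qed.

Lemma hausdorff_attractor_fin : hausdorff s E \is a fin_num.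
Proof. by rewrite ge0_fin_numE ?outer_measure_ge0. Qed.

Lemma le_hausdorff_words m (B : set 'rV[R]_n.+1) (P : pred (seq 'I_l)) :
  B `<=` \bigcup_(w in [set w | w \in words m /\ P w]) (wm w @` E) ->
  (hausdorff s B <= (\sum_(w <- words m | P w) wl w `^ s)%:E * hausdorff s E)%E.
Proof.
move=> BW; apply: (@le_trans _ _ (\sum_(w <- [seq w <- words m | P w]) hausdorff s (wm w @` E))%E).
  apply: outer_measure_seq => x /BW[w [wm' Pw] wx]; exists w => //.
  by rewrite mem_filter Pw.
rewrite big_filter -sumEFin ge0_sume_distrl; last by move=> i _; rewrite lee_fin powR_ge0.
by apply: lee_sum => w _; rewrite hausdorff_wmap.
Qed.

(** If the sum [P] exceeded 1, the weights [lam i `^ s / P] would still be bounded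
    by [lam i `^ t] for some [t > s], and [E] would have positive measure in
    dimension [t]. *)
Lemma moran : \sum_i lam i `^ s = 1.
Proof.
set P := \sum_i _; have Hf := hausdorff_attractor_fin.
apply/eqP; rewrite eq_le; apply/andP; split.
  rewrite leNgt; apply/negP => P1; have P0 : 0 < P by apply: lt_trans P1.
  have [lm [lM [/andP[lm0 lm1] lM1 lM0 hl]]] := lam_bounds hlam.
  (* [b] is below all the ratios and [b `^ e] is the inverse of [P]. *)
  pose b := lm / 2; have b0 : 0 < b by rewrite divr_gt0.
  have b1 : b < 1 by rewrite ltr_pdivrMr// mul1r; apply: le_lt_trans lm1 _; rewrite ltr1n.
  have lb : ln b < 0 by rewrite ln_lt0// b0.
  pose e := - ln P / ln b; have e0 : 0 < e.
    by rewrite /e nmulr_lgt0 ?invr_lt0// oppr_lt0 ln_gt0.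
  have be : P^-1 = b `^ e.
    rewrite /powR gt_eqF// /e mulrAC -mulrA mulfV ?lt_eqF// mulr1.
    by rewrite -lnV ?posrE// lnK// posrE invr_gt0.
  have : (0 < hausdorff (s + e) E)%E.
    apply: (hausdorff_gt0 (p := fun i => lam i `^ s / P)) => //.
    - by rewrite addr_ge0// ltW.
    - move=> i; have /andP[li _] := hl i; have /andP[l0 _] := hlam i.
      rewrite divr_ge0 ?powR_ge0 ?(ltW P0)//= powRD; last by apply/implyP => _; rewrite gt_eqF.
      rewrite ler_wpM2l ?powR_ge0// be; apply: ge0_ler_powR; rewrite ?nnegrE ?ltW//.
      by apply: lt_le_trans li; rewrite ltr_pdivrMr// ltr_pMr// ltr1n.
    - by rewrite -mulr_suml divff// gt_eqF.
  by rewrite (hausdorff_dim_gt0 hs) ?ltxx// ltrDl.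
rewrite -lee_fin -(@lee_pmul2r _ (hausdorff s E))// mul1e.
have -> : P = \sum_(w <- words 1) wl w `^ s.
  by rewrite -[LHS]expr1 -sum_words; apply: eq_bigr => w _; rewrite weight_powR.
apply: (@le_hausdorff_words 1 E xpredT) => x /(attractor_words 1)[w wm' wx].
by exists w.
Qed.

(** At each level the weights sum to 1, so that subadditivity over the remaining
    words of the level forces the reverse inequality. *)
Lemma hausdorff_words_ge m (P : pred (seq 'I_l)) :
  ((\sum_(w <- words m | P w) wl w `^ s)%:E * hausdorff s E <=
   hausdorff s (\bigcup_(w in [set w | w \in words m /\ P w]) (wm w @` E)))%E.
Proof.
have Hf := hausdorff_attractor_fin.
have sum1 : \sum_(w <- words m) wl w `^ s = 1.
  by rewrite -(expr1n _ m) -moran -sum_words; apply: eq_bigr => w _; rewrite weight_powR.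
set C := \bigcup_(w in _) _.
have := @le_hausdorff_words m (E `\` C) (predC P) _.
have : (hausdorff s E <= hausdorff s C + hausdorff s (E `\` C))%E.
  apply: le_trans (outer_measureU2 _ _ _); apply: le_outer_measure => x Ex.
  by have [Cx|Cx] := pselect (C x); [left|right].
have Cf : hausdorff s C \is a fin_num.
  rewrite ge0_fin_numE ?outer_measure_ge0//.
  apply: le_lt_trans Efin; apply: le_outer_measure => _ [w _ [x Ex <-]].
  exact: attractor_sub.
move=> h1 h2.
have {}h2 : (hausdorff s (E `\` C) <=
    (\sum_(w <- words m | ~~ P w) wl w `^ s)%:E * hausdorff s E)%E.
  apply: h2 => x [/(attractor_words m)[w wm' wx] nC]; exists w => //; split=> //=.
  by apply/negP => Pw; apply: nC; exists w.
have := le_trans h1 (leeD2l _ h2); rewrite -(fineK Cf) -(fineK Hf) -!EFinM -EFinD !lee_fin.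
rewrite (bigID P)/= in sum1; move: sum1.
set a := \sum_(w <- _ | P w) _; set b := \sum_(w <- _ | ~~ P w) _.
move=> ab; have -> : b = 1 - a by rewrite -ab addrAC subrr add0r.
by rewrite mulrBl mul1r addrCA lerDl subr_ge0.
Qed.

End Dimension.

End SelfSimilar.

(** * Slices by a Lipschitz function *)

Lemma ae_imp d (T : sigmaRingType d) (R : realType) (mu : set T -> \bar R)
    (P Q : T -> Prop) : (forall x, P x -> Q x) ->
  almost_everywhere mu P -> almost_everywhere mu Q.
Proof.
move=> PQ [N [mN N0 PN]]; exists N; split=> // x nQ; apply: PN => Px.
exact/nQ/PQ.
Qed.

Lemma ae_and d (T : measurableType d) (R : realType) (mu : {measure set T -> \bar R})
    (P Q : T -> Prop) : almost_everywhere mu P -> almost_everywhere mu Q ->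
  almost_everywhere mu (fun x => P x /\ Q x).
Proof.
move=> hP hQ; rewrite /almost_everywhere (_ : [set _ | _] = P `&` Q)// setCI.
exact: negligibleU.
Qed.

Section Eilenberg.
Local Open Scope ereal_scope.
Context {R : realType} {n : nat}.
Variables (f : 'rV[R]_n.+1 -> R) (L t : R).
Hypotheses (L0 : (0 < L)%R) (t0 : (0 <= t)%R)
  (fL : forall x y, (`|f x - f y| <= L * enorm (x - y))%R).
Local Notation leb := (@lebesgue_measure R).

(** A set [F] contributes to the slices over an interval of length at most
    [2 * L * ediam F] only. *)
Let slice_gauge (F : set 'rV[R]_n.+1) (delta : R) : ediam F <= delta%:E ->
  exists v : R -> \bar R, [/\ measurable_fun [set: R] v, forall x, 0 <= v x,
    forall x, hgauge t (F `&` f @^-1` [set x]) <= v x &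
    \int[leb]_x v x <= (2 * L)%:E * hgauge (t + 1) F].
Proof.
move=> Fd; have [F0|/set0P[y Fy]] := eqVneq F set0.
  exists (cst 0); split=> //.
    by move=> x; rewrite F0 set0I hgauge0.
  by rewrite integral_cst// mul0e F0 hgauge0 mule0.
have F0 : F !=set0 by exists y.
have Ff := ediam_fin Fd; pose D := fine (ediam F).
have D0 : (0 <= D)%R by rewrite fine_ge0// ediam_ge0.
pose I : set R := `[(f y - L * D)%R, (f y + L * D)%R]%classic.
have mI : measurable I by exact: measurable_itv.
exists (fun x => (D `^ t)%:E * (\1_I x)%:E); split.
- apply: measurable_funeM; apply/measurable_EFinP; exact: measurable_indic.
- by move=> x; rewrite -EFinM lee_fin mulr_ge0 ?powR_ge0// indicE ler0n.
- move=> x; rewrite indicE; case: (boolP (x \in I)) => [_|/negP xI].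
    rewrite mule1; apply: hgauge_le => //; rewrite fineK//.
    by apply: le_ediam; exact: subIsetl.
  rewrite mule0 (_ : _ `&` _ = set0) ?hgauge0//.
  apply/seteqP; split=> // z [Fz /= zx]; apply: xI; apply: mem_set; rewrite /I /= in_itv/=.
  have := fL z y; rewrite zx.
  have : (enorm (z - y) <= D)%R by rewrite -lee_fin fineK//; exact: ediam_ub.
  rewrite -(ler_pM2l L0) => h1 /le_trans/(_ h1); rewrite ler_distlC => /andP[h2 h3].
  by apply/andP; split; lra.
- rewrite ge0_integralZl//; last by rewrite lee_fin powR_ge0.
  + rewrite integral_indic// setIT hgaugeE// -/D.
    change ((D `^ t)%:E * leb I <= (2 * L)%:E * (D `^ (t + 1))%:E).
    have -> : leb I = _ := lebesgue_measure_itv `[(f y - L * D)%R, (f y + L * D)%R].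
    rewrite /=.
    case: ifP => _; last by rewrite mule0 mule_ge0// lee_fin ?powR_ge0// mulr_ge0// ltW.
    have := @mulr_powRB1 R D (t + 1)%R D0; rewrite addrK => <-; last by rewrite ltr_wpDl.
    by rewrite -EFinD -!EFinM lee_fin le_eqVlt; apply/orP; left; apply/eqP; ring.
  + apply/measurable_EFinP; exact: measurable_indic.
Qed.

Let slice_content (A : set 'rV[R]_n.+1) (k : nat) : hausdorff (t + 1) A < +oo ->
  exists v : R -> \bar R, [/\ measurable_fun [set: R] v, forall x, 0 <= v x,
    forall x, hcontent t k.+1%:R^-1 (A `&` f @^-1` [set x]) <= v x &
    \int[leb]_x v x <= (2 * L)%:E * (hausdorff (t + 1) A + k.+1%:R^-1%:E)].
Proof.
move=> Afin; have k0 : (0 < k.+1%:R^-1 :> R)%R by rewrite invr_gt0 ltr0n.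
have /hcontentP[F [Fd AF Fc]] :
    hcontent (t + 1) k.+1%:R^-1 A < hausdorff (t + 1) A + k.+1%:R^-1%:E.
  apply: (le_lt_trans (hcontent_hausdorff _ _ k0)).
  by rewrite -[ltLHS]adde0 lteD2lE// ?lte_fin// ge0_fin_numE ?outer_measure_ge0.
have [v Hv] := choice (fun j => slice_gauge (Fd j)).
have v0 j x : 0 <= v j x by have [] := Hv j.
exists (fun x => \sum_(j <oo) v j x); split.
- apply: ge0_emeasurable_sum => [j x _ _|j _]; first exact: v0.
  by have [] := Hv j.
- by move=> x; apply: nneseries_ge0.
- move=> x; apply: le_trans (hcontent_le (F := fun j => F j `&` f @^-1` [set x]) t _ _) _.
  + by move=> j; apply: le_trans (Fd j); apply: le_ediam; exact: subIsetl.
  + by move=> z [/AF[j _ Fz] zx]; exists j.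
  + apply: lee_nneseries => [j _ _|j _]; first exact: hgauge_ge0.
    by have [_ _ + _] := Hv j; exact.
- rewrite integral_nneseries//; last by move=> j; have [] := Hv j.
  apply: (@le_trans _ _ ((2 * L)%:E * \sum_(j <oo) hgauge (t + 1) (F j))); last first.
    by rewrite lee_pmul2l ?lte_fin ?mulr_gt0// ltW.
  rewrite -nneseriesZl; last by move=> j _; exact: hgauge_ge0.
  apply: lee_nneseries => [j _ _|j _]; first exact: integral_ge0.
  by have [] := Hv j.
Qed.

(** Eilenberg's inequality, with a measurable majorant in place of an upper
    integral. *)
Lemma eilenberg (A : set 'rV[R]_n.+1) : hausdorff (t + 1) A < +oo ->
  exists v : R -> \bar R, [/\ measurable_fun [set: R] v, forall x, 0 <= v x,
    forall x, hausdorff t (A `&` f @^-1` [set x]) <= v x &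
    \int[leb]_x v x <= (2 * L)%:E * hausdorff (t + 1) A].
Proof.
move=> Afin; have [v Hv] := choice (fun k => slice_content k Afin).
have v0 j x : 0 <= v j x by have [] := Hv j.
have mv j : measurable_fun [set: R] (v j) by have [] := Hv j.
have lim0 (u : nat -> \bar R) : (forall k, 0 <= u k) -> 0 <= limn_einf u.
  move=> u0; rewrite limn_einf_lim; apply: lime_ge; first exact: is_cvg_einfs.
  by apply: nearW => m; apply: le_ereal_inf_tmp => _ [k _ <-].
exists (fun x => limn_einf (v ^~ x)); split.
- rewrite (_ : (fun _ => _) = (fun x => - limn_esup (fun k => - v k x))).
    by apply: measurableT_comp => //; apply: measurable_fun_limn_esup => k;
      apply: measurableT_comp.
  by apply/funext.
- by move=> x; exact: lim0.
- move=> x; apply: hausdorff_le => k; rewrite limn_einf_lim.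
  apply: lime_ge; first exact: is_cvg_einfs.
  exists k => // m /= km; apply: le_ereal_inf_tmp => _ [j /= mj <-].
  have [_ _ + _] := Hv j; move=> /(_ x); apply: le_trans; apply: hcontent_anti.
  by rewrite lef_pV2 ?posrE ?ltr0n// ler_nat ltnS (leq_trans km).
- apply: (@le_trans _ _ (limn_einf (fun k => \int[leb]_x v k x))).
    exact: (fatou leb measurableT mv (fun k x _ => v0 k x)).
  rewrite limn_einf_lim; apply/lee_addgt0Pr => e e0.
  apply: lime_le; first exact: is_cvg_einfs.
  exists (Num.truncn (2 * L / e)) => // m /= mk.
  apply: (@le_trans _ _ (\int[leb]_x v m x)).
    by apply: ereal_inf_lbound; exists m => //=.
  have [_ _ _ /le_trans] := Hv m; apply.
  rewrite ge0_muleDr ?outer_measure_ge0// ?lee_fin// leeD2l// -EFinM lee_fin.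
  rewrite ler_pdivrMr ?ltr0n// [leRHS]mulrC -ler_pdivrMr//.
  by apply/ltW/(lt_le_trans (truncnS_gt _)); rewrite ler_nat ltnS.
Qed.

Lemma eilenberg_null (A : set 'rV[R]_n.+1) : hausdorff (t + 1) A = 0 ->
  {ae leb, forall x, hausdorff t (A `&` f @^-1` [set x]) = 0}.
Proof.
move=> A0; have [|v [mv v0 Av]] := @eilenberg A; first by rewrite A0 ltry.
rewrite A0 mule0 => iv.
have : {ae leb, forall x, setT x -> v x = 0}.
  apply/(ae_eq_integral_abs leb measurableT mv)/eqP.
  rewrite eq_le integral_ge0// andbT; apply: le_trans iv.
  by apply: ge0_le_integral => //=; [exact: measurableT_comp|move=> x _; rewrite gee0_abs].
apply: ae_imp => x /(_ I) vx; apply/eqP.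
by rewrite eq_le outer_measure_ge0 andbT -vx.
Qed.

End Eilenberg.

Section SliceMeasurable.
Local Open Scope ereal_scope.
Context {R : realType} {n : nat}.
Variables (f : 'rV[R]_n.+1 -> R) (t : R).
Hypotheses (t0 : (0 <= t)%R) (cf : continuous f).
Implicit Types (B C : set 'rV[R]_n.+1).

(** The second component of a member of the cover bounds the diameter of the first;
    it is positive, so that its powers behave well, and it makes the bound on the
    gauges independent of the set that is covered. *)
Definition fcover (delta c : R) B (s : seq (set 'rV[R]_n.+1 * R)) : Prop :=
  [/\ forall p, p \in s -> [/\ open p.1, (0 < p.2 <= delta)%R &
      (forall x y, p.1 x -> p.1 y -> (enorm (x - y) <= p.2)%R)],
    (forall x, B x -> exists2 p, p \in s & p.1 x) &
    (\sum_(p <- s) p.2 `^ t < c)%R].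

Lemma hcontent_fcover delta c B s : (0 <= delta)%R -> fcover delta c B s ->
  hcontent t delta B <= c%:E.
Proof.
move=> d0 [Hs Bs sc]; pose F k := (nth (set0, 0%R) s k).1.
have Fout k : (size s <= k)%N -> F k = set0 by move=> sk; rewrite /F nth_default.
apply: (le_trans (hcontent_le (F := F) t _ _)).
- move=> k; have [sk|sk] := leqP (size s) k; first by rewrite Fout// ediam0 lee_fin.
  have [_ /andP[_ pd] pU] := Hs _ (mem_nth (set0, 0%R) sk).
  by apply/(ediam_leP _ d0) => x y Fx Fy; apply: le_trans pd; exact: pU.
- move=> x /Bs[p ps px]; exists (index p s) => //.
  by rewrite /F nth_index.
- rewrite (nneseries_split _ (size s)); last by move=> k _; exact: hgauge_ge0.
  rewrite [X in _ + X]eseries0 ?adde0; last by move=> k sk _; rewrite Fout// hgauge0.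
  rewrite add0n; apply: (@le_trans _ _ (\sum_(p <- s) p.2 `^ t)%:E); last by rewrite lee_fin ltW.
  rewrite -sumEFin (big_nth (set0, 0%R)) !big_mkord; apply: lee_sum => k _.
  have [_ /andP[p0 _] pU] := Hs _ (mem_nth (set0, 0%R) (ltn_ord k)).
  by apply: hgauge_le; [|exact: ltW|apply/(ediam_leP _ (ltW p0)); exact: pU].
Qed.

(** A finite open cover of a slice of a compact set covers the nearby slices too,
    so that the slices with a cheap cover form an open set. *)
Lemma fcover_tube C delta c x s : compact C -> fcover delta c (C `&` f @^-1` [set x]) s ->
  exists2 O : set R, open O /\ O x & fcover delta c (C `&` f @^-1` O) s.
Proof.
move=> cC [Hs Cs sc]; pose U := \bigcup_(p in [set p | p \in s]) p.1.
have oU : open U by apply: bigcup_open => p /= /Hs[].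
have cK : compact (C `&` ~` U) by apply: compact_closedI => //; exact: open_closedC.
have cfK : closed (f @` (C `&` ~` U)).
  apply: compact_closed; first exact: Rhausdorff.
  by apply: continuous_compact => //; exact: continuous_subspaceT.
exists (~` (f @` (C `&` ~` U))); last split => //.
  split; first exact: closed_openC.
  by move=> [z [Cz Uz] zx]; apply: Uz; have [p ps pz] := Cs z (conj Cz zx); exists p.
move=> z [Cz nU]; have [[p ps pz]|nUz] := pselect (U z); first by exists p.
by case: nU; exists z.
Qed.

Lemma closed_fiber x : closed (f @^-1` [set x]).
Proof.
apply: closed_comp => [z _|]; first exact: cf.
by apply: accessible_closed_set1; apply: hausdorff_accessible; exact: Rhausdorff.
Qed.

(** The slices at which the measure exceeds [c] are those which have, for some mesh,
    no cover of cost close to [c]; and the slices with such a cover form an open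
    set. *)
Lemma measurable_slice C : compact C ->
  measurable_fun [set: R] (fun x : R => hausdorff t (C `&` f @^-1` [set x])).
Proof.
move=> cC; apply: (measurability _ (ErealGenOInfty.measurableE R)) => //.
move=> /= _ [_ [c ->]] <-; rewrite setTI.
pose G k m := [set x | exists s,
  fcover (2 * k.+1%:R^-1) (c + m.+1%:R^-1) (C `&` f @^-1` [set x]) s].
have oG k m : open (G k m).
  rewrite openE => x [s /(fcover_tube cC)[W [oW Wx] sW]].
  apply: (filterS _ (open_nbhs_nbhs (conj oW Wx))) => y Wy; exists s.
  have [h1 h2 h3] := sW; split=> // z [Cz zy]; apply: h2; split=> //.
  by rewrite /= zy.
rewrite (_ : _ @^-1` _ = \bigcup_k \bigcup_m ~` G k m).
  apply: bigcup_measurable => k _; apply: bigcup_measurable => m _.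
  by apply: measurableC; exact: open_measurable.
apply/seteqP; split=> x /=; rewrite in_itv/= andbT; last first.
  move=> [k _ [m _ nG]]; rewrite ltNge; apply/negP => hc; apply: nG.
  have k0 : (0 < k.+1%:R^-1 :> R)%R by rewrite invr_gt0 ltr0n.
  apply: (hcontent_compact_cover t0 k0).
    by apply: compact_closedI => //; exact: closed_fiber.
  apply: (@le_lt_trans _ _ c%:E); last by rewrite lte_fin ltrDl invr_gt0 ltr0n.
  by apply: le_trans hc; exact: hcontent_hausdorff.
move=> hc; apply: contrapT => nG; move: hc; apply/negP; rewrite -leNgt.
apply: ge_ereal_sup => _ [delta /= d0 <-]; apply/lee_addgt0Pr => e e0.
pose k := Num.truncn (2 / delta)%R; pose m := Num.truncn e^-1.
have [s sG] : G k m x.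
  by apply: contrapT => nGk; apply: nG; exists k => //; exists m.
have k2 : (2 * k.+1%:R^-1 <= delta)%R.
  rewrite ler_pdivrMr ?ltr0n// [leRHS]mulrC -ler_pdivrMr//; exact/ltW/truncnS_gt.
apply: (le_trans (hcontent_anti t _ k2)).
apply: (le_trans (hcontent_fcover _ sG)); first by rewrite mulr_ge0// invr_ge0.
rewrite -EFinD lee_fin lerD2l -[leRHS]invrK lef_pV2 ?posrE ?invr_gt0 ?ltr0n//.
exact/ltW/truncnS_gt.
Qed.

End SliceMeasurable.

(** * Lebesgue measure on the line *)

Section Lebesgue.
Local Open Scope ereal_scope.
Context {R : realType}.
Local Notation leb := (@lebesgue_measure R).

Section affine.
Variables a b : R.
Hypothesis a0 : (0 < a)%R.
Let phi (x : measurableTypeR R) : measurableTypeR R := (a * x + b)%R.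

Let mphi : measurable_fun [set: measurableTypeR R] phi.
Proof.
apply: continuous_measurable_fun => x.
by apply: cvgD; [apply: cvgM; [exact: cvg_cst|exact: cvg_id]|exact: cvg_cst].
Qed.

Let image_phi : {measure set (measurableTypeR R) -> \bar R} :=
  measure_function_pushforward__canonical__measure_function_Measure leb mphi.

Let scaled : {measure set (measurableTypeR R) -> \bar R} := mscale (NngNum (ltW a0)) image_phi.

Let scaledE (A : set R) : measurable A -> leb A = scaled A.
Proof.
move=> mA; apply: lebesgue_measure_unique => //= _ [[p q]] _ <-.
rewrite /scaled /= /mscale/= /pushforward.
have -> : phi @^-1` [set` `]p, q]] = `](p - b) / a, (q - b) / a]%classic%R.
  apply/seteqP; split => x; rewrite /= !in_itv/= ltr_pdivrMr// ler_pdivlMr//.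
    by rewrite ltrBlDr lerBrDr mulrC.
  by rewrite ltrBlDr lerBrDr mulrC.
rewrite !lebesgue_measure_itv/= !lte_fin ltr_pM2r ?invr_gt0// ltrD2r.
case: ifPn => pq; last by rewrite mule0.
by rewrite -!EFinD -EFinM; congr EFin; field; rewrite gt_eqF.
Qed.

Lemma integral_affine (f : R -> \bar R) : measurable_fun [set: R] f ->
  (forall x, 0 <= f x) -> \int[leb]_x f x = a%:E * \int[leb]_x f (a * x + b)%R.
Proof.
move=> mf f0; transitivity (\int[scaled]_x f x).
  by apply: eq_measure_integral => A mA _; exact: scaledE.
by rewrite ge0_integral_mscale//; congr (_ * _); rewrite ge0_integral_pushforward.
Qed.

Lemma measurable_preimage_affine (A : set R) : measurable A ->
  measurable ((fun x => a * x + b)%R @^-1` A : set R).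
Proof. by move=> mA; rewrite -[X in measurable X]setTI; exact: mphi. Qed.

Lemma lebesgue_preimage_affine (A : set R) : measurable A ->
  leb ((fun x => a * x + b)%R @^-1` A) = a^-1%:E * leb A.
Proof.
move=> mA; rewrite (scaledE mA) /scaled/= /mscale/= muleA -EFinM mulVf ?gt_eqF//.
by rewrite mul1e.
Qed.

End affine.

(** A measure that is locally at most [c] times Lebesgue measure is so globally,
    because countably many rational intervals suffice. *)
Lemma local_lebesgue_bound (rho : {outer_measure set R -> \bar R}) (c : R) (J : set R) :
  (0 <= c)%R -> measurable J ->
  (forall B, measurable B -> leb B = 0 -> rho B = 0) ->
  {ae leb, forall x, exists O : set R, [/\ open O, O x &
    forall B, measurable B -> B `<=` O -> rho B <= c%:E * leb B]} ->
  rho J <= c%:E * leb J.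
Proof.
move=> c0 mJ rho0 loc.
pose good (O : set R) := forall B, measurable B -> B `<=` O -> rho B <= c%:E * leb B.
pose K (k : nat) : set R := if choice.unpickle k is Some pq then
  let W := `](ratr pq.1 : R), (ratr pq.2 : R)[%classic in
  if `[< good W >] then W else set0 else set0.
have good0 : good set0.
  move=> B _ B0; have -> : B = set0 by apply/seteqP; split.
  by rewrite outer_measure0 measure0 mule0.
have gK k : good (K k).
  by rewrite /K; case: (choice.unpickle _) => [pq|//] /=; case: asboolP.
have mK k : measurable (K k).
  rewrite /K; case: (choice.unpickle _) => [pq|] //=; case: asboolP => // _; exact: measurable_itv.
have mQ : measurable (\bigcup_k K k) by exact: bigcup_measurable.
have Q0 : leb (~` \bigcup_k K k) = 0.
  case: loc => N [mN N0 sub]; apply/eqP; rewrite eq_le measure_ge0 andbT -N0.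
  apply: le_measure; [by apply: mem_set; exact: measurableC|exact: mem_set|].
  apply: subset_trans sub => x nQ [W [oW Wx gW]]; apply: nQ.
  move: oW; rewrite openE => /(_ _ Wx) /nbhs_ballP[r /= r0 xr].
  have [p] : exists p : rat, ratr p \in `](x - r)%R, x[ by apply: rat_in_itvoo; rewrite ltrBlDr ltrDl.
  have [q] : exists q : rat, ratr q \in `]x, (x + r)%R[ by apply: rat_in_itvoo; rewrite ltrDl.
  rewrite !in_itv/= => /andP[xq qr] /andP[rp px].
  have [k kE] : exists k : nat, choice.unpickle k = Some (p, q).
    by exists (choice.pickle (p, q)); rewrite choice.pickleK.
  exists k; [by []|rewrite /K kE /=; case: asboolP => [_|]].
    by rewrite /= in_itv/= px xq.
  case=> B mB BW; apply: gW => // y /BW; rewrite /= in_itv/= => /andP[py yq].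
  by apply: xr; rewrite -ball_normE/= ltr_distlC; apply/andP; split; lra.
pose B k := J `&` seqDU K k.
have mB k : measurable (B k).
  by apply: measurableI => //; apply: measurableD => //; exact: bigsetU_measurable.
have JE : J `<=` (J `&` ~` \bigcup_k K k) `|` \bigcup_k B k.
  move=> x Jx; have [Qx|] := pselect ((\bigcup_k K k) x); [right|by left].
  by move: Qx; rewrite seqDU_bigcup_eq => -[k _ kx]; exists k.
apply: (le_trans (le_outer_measure rho _ _ JE)).
apply: (le_trans (outer_measureU2 _ _ _)).
rewrite (rho0 (J `&` _)); last 2 first.
- by apply: measurableI => //; exact: measurableC.
- apply/eqP; rewrite eq_le measure_ge0 andbT -Q0; apply: le_measure => //.
  + by apply: mem_set; apply: measurableI => //; exact: measurableC.
  + by apply: mem_set; exact: measurableC.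
rewrite add0e; apply: (le_trans (outer_measure_sigma_subadditive _ _)).
apply: (@le_trans _ _ (\sum_(k <oo) c%:E * leb (B k))).
  apply: lee_nneseries => [k _ _|k _]; first exact: outer_measure_ge0.
  by apply: (gK k) => // x [_ []].
rewrite nneseriesZl; last by move=> k _; exact: measure_ge0.
rewrite lee_wpmul2l ?lee_fin//.
have mUB : measurable (\bigcup_k B k) by apply: bigcup_measurable => k _; exact: mB.
rewrite -measure_semi_bigcup//; last by apply: trivIset_setIl; exact: trivIset_seqDU.
apply: le_measure; [exact: mem_set|exact: mem_set|].
by move=> x [k _ []].
Qed.

End Lebesgue.

(** * Integrals of nonnegative functions *)

Section Induction.
Local Open Scope ereal_scope.
Context d (T : measurableType d) (R : realType).
Variable P : (T -> \bar R) -> Prop.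
Hypotheses (P_indic : forall A, measurable A -> P (fun x => (\1_A x)%:E))
  (P_scale : forall (k : R) f, (0 <= k)%R -> measurable_fun setT f ->
    (forall x, 0 <= f x) -> P f -> P (fun x => k%:E * f x))
  (P_add : forall f g, measurable_fun setT f -> measurable_fun setT g ->
    (forall x, 0 <= f x) -> (forall x, 0 <= g x) -> P f -> P g -> P (fun x => f x + g x))
  (P_lim : forall F : (T -> \bar R)^nat, (forall k, measurable_fun setT (F k)) ->
    (forall k x, 0 <= F k x) -> (forall x, nondecreasing_seq (F ^~ x)) ->
    (forall k, P (F k)) -> P (fun x => limn (F ^~ x))).

Import HBNNSimple.

Lemma ge0_measurable_ind f :
  measurable_fun setT f -> (forall x, 0 <= f x) -> P f.
Proof.
move=> mf f0; pose g := nnsfun_approx measurableT mf.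
have -> : f = fun x => limn (fun k => (g k x)%:E).
  by apply/funext => x; apply/esym/cvg_lim => //; exact: cvg_nnsfun_approx.
apply: P_lim.
- by move=> k; apply/measurable_EFinP; exact: measurable_funP.
- by move=> k x; rewrite lee_fin.
- by move=> x i j ij; rewrite lee_fin; exact/lefP/nd_nnsfun_approx.
move=> k; pose r := finmap.enum_fset (fset_set (range (g k))).
have -> : (fun x => (g k x)%:E) =
    fun x => \sum_(y <- r) y%:E * (\1_(g k @^-1` [set y]) x)%:E.
  apply/funext => x; rewrite fimfunE fsbig_finite//= -sumEFin.
  by apply: eq_bigr => y _; rewrite EFinM.
have r0 y : y \in r -> (0 <= y)%R.
  by rewrite /r; rewrite -[_ \in finmap.enum_fset _]/(y \in fset_set (range (g k)))
    in_fset_set// => /set_mem[x _ <-].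
elim: r r0 => [|y r IH] r0.
  have -> : (fun x : T => \sum_(y <- [::]) y%:E * (\1_(g k @^-1` [set y]) x)%:E) =
      fun x => 0%:E * (\1_(set0 : set T) x)%:E.
    by apply/funext => x; rewrite big_nil mul0e.
  apply: P_scale => //; last exact: P_indic.
  by apply/measurable_EFinP; exact: measurable_indic.
have mi z : measurable (g k @^-1` [set z]) by [].
have mi' z : measurable_fun setT (fun x => (\1_(g k @^-1` [set z]) x)%:E : \bar R).
  by apply/measurable_EFinP; exact: measurable_indic.
have ge z x : 0 <= (\1_(g k @^-1` [set z]) x)%:E :> \bar R by rewrite lee_fin.
have -> : (fun x : T => \sum_(y <- y :: r) y%:E * (\1_(g k @^-1` [set y]) x)%:E) =
    fun x => y%:E * (\1_(g k @^-1` [set y]) x)%:E +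
      \sum_(y <- r) y%:E * (\1_(g k @^-1` [set y]) x)%:E.
  by apply/funext => x; rewrite big_cons.
have y0 : (0 <= y)%R by apply: r0; exact: mem_head.
have r0' z : z \in r -> (0 <= z)%R by move=> zr; apply: r0; rewrite in_cons zr orbT.
apply: P_add.
- by apply: measurable_funeM.
- by apply: emeasurable_sum => z; exact: measurable_funeM.
- by move=> x; rewrite mule_ge0.
- by move=> x; rewrite big_seq; apply: sume_ge0 => z /r0' z0; rewrite mule_ge0.
- by apply: P_scale => //; exact: P_indic.
- exact: IH.
Qed.

End Induction.

Lemma nondecreasing_integral_cvg d (T : measurableType d) (R : realType)
    (mu : {measure set T -> \bar R}) (D : set T) (F : (T -> \bar R)^nat) :
  measurable D -> (forall k, measurable_fun D (F k)) ->
  (forall k x, D x -> (0 <= F k x)%E) -> (forall x, D x -> nondecreasing_seq (F ^~ x)) ->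
  (\int[mu]_(x in D) F k x)%E @[k --> \oo] --> (\int[mu]_(x in D) limn (F ^~ x))%E.
Proof. by move=> mD mF F0 ndF; exact: cvg_monotone_convergence. Qed.

Lemma ge0_integral_density d (T : measurableType d) (R : realType)
    (mu nu : {measure set T -> \bar R}) (k : T -> R) :
  measurable_fun setT k -> (forall x, 0 <= k x) ->
  (forall A, measurable A -> nu A = \int[mu]_(x in A) (k x)%:E)%E ->
  forall f, measurable_fun setT f -> (forall x, 0 <= f x)%E ->
  (\int[nu]_x f x = \int[mu]_x (f x * (k x)%:E))%E.
Proof.
move=> mk k0 nuk; have k0' x : (0 <= (k x)%:E)%E by rewrite lee_fin.
have mk' : measurable_fun setT (fun x => (k x)%:E) by exact/measurable_EFinP.
apply: ge0_measurable_ind.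
- move=> A mA; rewrite integral_indic// setIT nuk// [LHS]integral_mkcond.
  apply: eq_integral => x _; rewrite patchE indicE.
  by case: ifP => _; rewrite ?mul1e ?mul0e.
- move=> c f c0 mf f0 IH; rewrite ge0_integralZl// IH -ge0_integralZl//.
  + by apply: eq_integral => x _; rewrite muleA.
  + exact: emeasurable_funM.
  + by move=> x _; rewrite mule_ge0.
- move=> f g mf mg f0 g0 If Ig; rewrite ge0_integralD// If Ig -ge0_integralD//.
  + by apply: eq_integral => x _; rewrite ge0_muleDl.
  + by move=> x _; rewrite mule_ge0.
  + exact: emeasurable_funM.
  + by move=> x _; rewrite mule_ge0.
  + exact: emeasurable_funM.
- move=> F mF F0 ndF IH.
  have h1 := @nondecreasing_integral_cvg _ _ _ nu setT F measurableT mF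
    (fun i x _ => F0 i x) (fun x _ => ndF x).
  have mFk i : measurable_fun setT (fun x => F i x * (k x)%:E)%E by exact: emeasurable_funM.
  have ndFk x : nondecreasing_seq (fun i => F i x * (k x)%:E)%E.
    by move=> i j ij; rewrite lee_wpmul2r//; exact: ndF.
  have h2 := @nondecreasing_integral_cvg _ _ _ mu setT (fun i x => F i x * (k x)%:E)%E
    measurableT mFk (fun i x _ => mule_ge0 (F0 i x) (k0' x)) (fun x _ => ndFk x).
  have -> : (\int[mu]_x (limn (F^~ x) * (k x)%:E) = \int[mu]_x limn (fun i => F i x * (k x)%:E))%E.
    apply: eq_integral => x _; apply/esym/cvg_lim => //.
    by apply: cvgeZr => //; apply: ereal_nondecreasing_is_cvgn; exact: ndF.
  rewrite (_ : (fun i => _) = fun i => \int[mu]_x (F i x * (k x)%:E))%E in h1.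
    exact: (cvg_unique _ h1 h2).
  by apply/funext => i; exact: IH.
Qed.

Section Transfer.
Local Open Scope ereal_scope.
Context {R : realType} {T : pointedType}.
Variables (m1 m2 : {outer_measure set T -> \bar R}) (D : set T) (c : R).
Hypotheses (c0 : (0 <= c)%R) (mD : m2.-caratheodory D)
  (m12 : forall A, A `<=` D -> m1 A = c%:E * m2 A)
  (cara : forall A, m2.-caratheodory A -> m1.-caratheodory A).

Lemma measurable_fun_transfer (f : T -> \bar R) :
  measurable_fun (D : set (caratheodory_type m2)) f ->
  measurable_fun (D : set (caratheodory_type m1)) f.
Proof.
by move=> mf _ Y mY; apply: cara; exact: mf.
Qed.

(** The two outer measures are carried by different sigma-algebras; the identity is
    a measurable map between them, along which the integral is pushed forward. *)
Lemma integral_transfer (f : T -> \bar R) :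
  measurable_fun (D : set (caratheodory_type m2)) f ->
  (forall x, D x -> 0 <= f x) ->
  \int[cmeasure m1]_(x in D) f x = c%:E * \int[cmeasure m2]_(x in D) f x.
Proof.
move=> mf f0; pose phi : caratheodory_type m1 -> caratheodory_type m2 := idfun.
have mphi : measurable_fun setT phi.
  by move=> _ A mA; rewrite setTI; exact: cara.
pose push : {measure set (caratheodory_type m2) -> \bar R} :=
  measure_function_pushforward__canonical__measure_function_Measure (cmeasure m1) mphi.
transitivity (\int[push]_(x in D) f x).
  rewrite ge0_integral_pushforward// => x xD.
  by apply: f0; exact: set_mem.
transitivity (\int[mscale (NngNum c0) (cmeasure m2)]_(x in D) f x).
  by apply: eq_measure_integral => A mA AD; exact: m12.
by rewrite ge0_integral_mscale.
Qed.

End Transfer.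

Section Indic.
Local Open Scope ereal_scope.
Context d (T : measurableType d) (R : realType).
Variables (mu : {measure set T -> \bar R}) (A D : set T).
Hypotheses (mD : measurable D) (mAD : measurable (A `&` D)).

Let indicE_on : {in D, (fun x => (\1_(A `&` D) x)%:E : \bar R) =1 (fun x => (\1_A x)%:E)}.
Proof. by move=> x xD; rewrite !indicE in_setI xD andbT. Qed.

Lemma measurable_indic_on : measurable_fun D (fun x => (\1_A x)%:E : \bar R).
Proof.
apply: (eq_measurable_fun _ indicE_on); apply/measurable_EFinP.
by apply: measurable_funTS; exact: measurable_indic.
Qed.

Lemma integral_indic_on : \int[mu]_(x in D) (\1_A x)%:E = mu (A `&` D).
Proof.
rewrite -(eq_integral _ _ indicE_on) integral_indic// -setIA setIid//.
Qed.

End Indic.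

Lemma nondecreasing_einfsE (R : realType) (u : (\bar R)^nat) k :
  nondecreasing_seq u -> einfs u k = u k.
Proof.
move=> ndu; apply/eqP; rewrite eq_le; apply/andP; split.
  by apply: ereal_inf_lbound; exists k => /=.
by apply: le_ereal_inf_tmp => _ [j /= kj <-]; exact: ndu.
Qed.

Section CompleteMeasures.
Local Open Scope ereal_scope.
Context {R : realType} {T : pointedType}.
Variable mu : {outer_measure set T -> \bar R}.

Lemma caratheodory_complete : measure_is_complete (cmeasure mu).
Proof. exact: measure_is_complete_caratheodory. Qed.

Lemma ae_eq_integrable (D : set T) (f g : T -> \bar R) : mu.-caratheodory D ->
  oae mu (fun x => D x -> f x = g x) -> ointegrable mu D f ->
  ointegrable mu D g /\ ointegral mu D f = ointegral mu D g.
Proof.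
move=> mD fg /integrableP[mf fi].
have mg : measurable_fun (D : set (caratheodory_type mu)) g.
  exact: (ae_measurable_fun caratheodory_complete fg mf).
split; last exact: (@ae_eq_integral _ _ _ (cmeasure mu) D g f mD mf mg fg).
apply/integrableP; split => //; apply: le_lt_trans fi; rewrite le_eqVlt.
apply/orP; left; apply/eqP; apply: (@ge0_ae_eq_integral _ _ _ (cmeasure mu) D) => //.
- exact: measurableT_comp.
- exact: measurableT_comp.
- by apply: ae_imp fg => x fgx Dx; rewrite fgx.
Qed.

(** All subsets of a null set are measurable, hence so are all functions on it. *)
Lemma null_integral (D : set T) (f : T -> \bar R) : mu D = 0 ->
  ointegrable mu D f /\ ointegral mu D f = 0.
Proof.
move=> D0; have null A : A `<=` D -> mu.-caratheodory A.
  move=> AD; apply: null_caratheodory; apply/eqP.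
  by rewrite eq_le outer_measure_ge0 andbT -D0 le_outer_measure.
have mD : mu.-caratheodory D by exact: null.
have mf : measurable_fun (D : set (caratheodory_type mu)) f.
  by move=> _ Y _; apply: null; exact: subIsetl.
split; first exact: (@null_set_integrable _ _ _ (cmeasure mu) D f mD mf D0).
exact: (@null_set_integral _ _ _ (cmeasure mu) D f mD mf D0).
Qed.

(** A restricted measure has more measurable sets, but the same ones below the set
    to which it is restricted. *)
Lemma orestr_caratheodory (D A : set T) :
  mu.-caratheodory A -> (orestr mu D).-caratheodory A.
Proof.
move=> mA X; rewrite /orestr (mA (X `&` D)).
by rewrite [X `&` D `&` A]setIAC [X `&` D `&` ~` A]setIAC.
Qed.

Lemma onormalize_caratheodory (D A : set T) :
  mu.-caratheodory A -> (onormalize mu D).-caratheodory A.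
Proof.
move=> mA X; rewrite /onormalize (mA (X `&` D)) ge0_muleDl ?outer_measure_ge0//.
by rewrite [X `&` D `&` A]setIAC [X `&` D `&` ~` A]setIAC.
Qed.

Lemma caratheodory_orestr (D A : set T) : mu.-caratheodory D -> A `<=` D ->
  (orestr mu D).-caratheodory A -> mu.-caratheodory A.
Proof.
move=> mD AD mA X; rewrite (mD X) (mD (X `&` ~` A)) addeA; congr (_ + _).
  have := mA X; rewrite /orestr => ->; congr (mu _ + _).
  by rewrite -setIA (setIidl AD).
by congr (mu _); apply/seteqP; split=> x [] => [Xx nD|[Xx _] nD]; split=> //; split=> // /AD.
Qed.

Lemma orestr_integrable (D : set T) (f : T -> \bar R) : mu.-caratheodory D ->
  ointegrable (orestr mu D) D f -> ointegrable mu D f.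
Proof.
move=> mD /integrableP[mf fi].
have mf' : measurable_fun (D : set (caratheodory_type mu)) f.
  move=> _ Y mY; apply: (caratheodory_orestr mD); first exact: subIsetl.
  by apply: mf => //; exact: orestr_caratheodory.
apply/integrableP; split => //; move: fi.
have m12 A : A `<=` D -> orestr mu D A = 1%:E * mu A.
  by move=> AD; rewrite mul1e /orestr (setIidl AD).
have := @integral_transfer _ _ (orestr mu D) mu D 1%R ler01 mD m12
  (@orestr_caratheodory D) (fun x => `|f x|) (measurableT_comp (@abse_measurable R setT) mf')
  (fun x _ => abse_ge0 (f x)).
by rewrite mul1e => <-.
Qed.

End CompleteMeasures.

(** * Slices of a self-similar set *)

Section Projection.
Context {R : realType} {n : nat}.
Variable theta : 'I_n -> R.
Local Notation pi := (lproj theta).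

Lemma lproj_lip x y : `|pi x - pi y| <= (enorm (ldir theta) + 1) * enorm (x - y).
Proof.
rewrite /lproj -dotpBl mulrC; apply: (le_trans (dotp_CS _ _)).
by rewrite ler_wpM2l ?enorm_ge0// lerDl.
Qed.

Lemma lproj_lip_gt0 : 0 < enorm (ldir theta) + 1.
Proof. by rewrite ltr_pwDr// enorm_ge0. Qed.

Lemma lproj_continuous : continuous pi.
Proof.
move=> x A /nbhs_ballP[e /= e0 eA]; change (nbhs x (pi @^-1` A)).
have c0 : 0 < (enorm (ldir theta) + 1) by exact: lproj_lip_gt0.
have := @open_enorm_lt R n x (e / (enorm (ldir theta) + 1)).
rewrite openE => /(_ x) /=; rewrite subrr => h.
have {}h : nbhs x [set y | enorm (x - y) < e / (enorm (ldir theta) + 1)].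
  by apply: h; rewrite enorm0 divr_gt0.
move/nbhs_ballP: h => [r r0 hr]; apply/nbhs_ballP; exists r => // y /hr /=.
rewrite ltr_pdivlMr// mulrC.
by move=> xy; apply: eA; rewrite -ball_normE; apply: le_lt_trans xy; exact: lproj_lip.
Qed.

Lemma lproj_affine a b x : pi (a *: x + b) = a * pi x + pi b.
Proof. by rewrite /lproj dotpDl dotpZl. Qed.

Lemma closed_lproj_fiber x : closed (pi @^-1` [set x]).
Proof. exact/closed_fiber/lproj_continuous. Qed.

(** Preimages of Borel sets are measurable, since those of closed half-lines are
    closed. *)
Lemma lproj_preimage_caratheodory t (B : set R) : measurable B ->
  (hausdorff t).-caratheodory (pi @^-1` B).
Proof.
move=> mB; have /(_ measurableT B mB) : measurable_fun setT
    (pi : caratheodory_type (hausdorff t : set 'rV[R]_n.+1 -> \bar R) -> R).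
  apply: (measurability _ (RGenCInfty.measurableE R)) => //.
  move=> _ [_ [a ->] <-]; rewrite setTI.
  apply: hausdorff_closed; apply: closed_comp => [z _|]; first exact: lproj_continuous.
  exact: interval_closed.
by rewrite setTI.
Qed.

End Projection.

Section BoundedProjection.
Local Open Scope ereal_scope.
Context {R : realType} {n l : nat}.
Variables (lam : 'I_l -> R) (d : 'I_l -> 'rV[R]_n.+1) (E : set 'rV[R]_n.+1)
  (s M : R) (theta : 'I_n -> R).
Hypotheses (hlam : forall i, (0 < lam i < 1)%R) (hE : is_attractor lam d E)
  (hosc : open_set_condition lam d) (hs : hausdorff_dim E = s%:E)
  (Epos : 0 < hausdorff s E) (M0 : (0 <= M)%R).
Local Notation pi := (lproj theta).
Local Notation leb := (@lebesgue_measure R).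
Local Notation wl := (weight lam).
Local Notation wm := (wmap lam d).
Local Notation H := (hausdorff s).
Local Notation h A := (fun x : R => hausdorff (s - 1) (A `&` pi @^-1` [set x])).
Hypothesis hM : forall B : set R, measurable B -> H (E `&` pi @^-1` B) <= M%:E * leb B.

Lemma measurable_attractor : H.-caratheodory E.
Proof.
have [_ cE _] := hE.
by apply: hausdorff_closed; apply: compact_closed => //; exact: norm_hausdorff.
Qed.

Lemma slice_caratheodory x : (hausdorff (s - 1)).-caratheodory (slice E theta x).
Proof.
have [_ cE _] := hE; apply: hausdorff_closed; apply: closedI; last exact: closed_lproj_fiber.
by apply: compact_closed => //; exact: norm_hausdorff.
Qed.

Lemma attractor_in_interval : exists a : R, E `<=` pi @^-1` `[(- a)%R, a].
Proof.
have [_ cE _] := hE.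
have /compact_bounded[a [_ Ha]] : compact (pi @` E).
  by apply: continuous_compact => //; apply: continuous_subspaceT; exact: lproj_continuous.
exists (`|a| + 1)%R => x Ex /=; rewrite in_itv/= -ler_norml.
apply: (Ha (`|a| + 1)%R); last by exists x.
by rewrite (le_lt_trans (ler_norm _))// ltrDl.
Qed.

Lemma attractor_fin : H E < +oo.
Proof.
have [a Ea] := attractor_in_interval.
have -> : E = E `&` pi @^-1` `[(- a)%R, a] by apply/esym/setIidPl.
apply: (le_lt_trans (hM _)); first exact: measurable_itv.
by rewrite lebesgue_measure_itv/=; case: ifP => _; rewrite -?EFinD -?EFinM ?mule0 ltry.
Qed.

Let HEf : H E \is a fin_num.
Proof. by rewrite ge0_fin_numE ?outer_measure_ge0// attractor_fin. Qed.

Lemma hausdorff0_eq0 (A : set 'rV[R]_n.+1) : hausdorff 0 A = 0 -> A = set0.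
Proof.
move=> A0; have : hcontent 0 1 A < 1.
  by apply: (le_lt_trans (hcontent_hausdorff _ _ _)) => //; rewrite A0.
move=> /hcontentP[F [Fd AF Fc]]; apply/seteqP; split=> // x /AF[k _ Fx].
move: Fc; rewrite ltNge => /negP; apply.
have F1 : hgauge 0 (F k) = 1.
  rewrite hgaugeE ?powRr0//; first by exists x.
  exact: ediam_fin (Fd k).
rewrite -F1 (nneseries_split _ k.+1)//; last by move=> i _; exact: hgauge_ge0.
rewrite add0n big_nat_recr//= -addeA addeCA leeDl// adde_ge0//.
  by apply: sume_ge0 => i _; exact: hgauge_ge0.
by apply: nneseries_ge0 => i _ _; exact: hgauge_ge0.
Qed.

(** In dimension less than 1 the projection of [E] would be a null set. *)
Lemma dim_ge1 : (1 <= s)%R.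
Proof.
rewrite leNgt; apply/negP => s1.
have := @eilenberg_null R n pi _ 0%R (lproj_lip_gt0 theta) (lexx _) (lproj_lip theta) E.
rewrite add0r => /(_ (hausdorff_dim_gt0 hs s1)) [N [mN N0 sub]].
move: Epos; rewrite ltNge => /negP; apply.
have -> : E = E `&` pi @^-1` N.
  apply/esym/setIidPl => x Ex; apply: sub => /= /hausdorff0_eq0 /seteqP[+ _].
  by move=> /(_ x); apply.
by apply: le_trans (hM mN) _; rewrite N0 mule0.
Qed.

Let t0 : (0 <= s - 1)%R.
Proof. by rewrite subr_ge0 dim_ge1. Qed.

Let s0 : (0 <= s)%R.
Proof. exact: le_trans dim_ge1. Qed.

Let sE : (s = (s - 1) + 1)%R.
Proof. by rewrite subrK. Qed.

Lemma slice_null (A : set 'rV[R]_n.+1) : H A = 0 -> {ae leb, forall x, h A x = 0}.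
Proof.
rewrite {1}sE; exact: (eilenberg_null (lproj_lip_gt0 theta) t0 (lproj_lip theta)).
Qed.

Lemma measurable_compact_slice C : compact C -> measurable_fun [set: R] (h C).
Proof. by move=> cC; apply: measurable_slice => //; exact: lproj_continuous. Qed.

Lemma compact_piece w : compact (wm w @` E).
Proof.
have [_ cE _] := hE; apply: continuous_compact => //; apply: continuous_subspaceT.
rewrite (_ : wm w = fun x => wl w *: x + wm w 0)%R; last first.
  by apply/funext => x; exact: wmap_affine.
move=> x; apply: continuousD; last exact: cst_continuous.
exact: scaler_continuous.
Qed.

(** The map of a word carries fibres of the projection to fibres. *)
Lemma slice_piece w A (y : R) :
  h (wm w @` A) (wl w * y + pi (wm w 0))%R = (wl w `^ (s - 1))%:E * h A y.
Proof.
rewrite -(@hausdorff_wmap _ _ _ lam d hlam _ w _ t0); congr hausdorff; apply/seteqP; split => x.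
  move=> [[z Az <-] /=]; rewrite (wmap_affine lam d) lproj_affine => /addIr.
  move=> /(mulfI (lt0r_neq0 (wl_gt0 hlam w))) zy; exists z => //.
  by rewrite -(wmap_affine lam d).
move=> [z [Az /= zy] <-]; split; first by exists z.
by rewrite /= (wmap_affine lam d) lproj_affine zy.
Qed.

Definition slice_mass : \bar R := \int[leb]_x h E x.

Lemma slice_mass_ge0 : 0 <= slice_mass.
Proof. by apply: integral_ge0 => x _; exact: outer_measure_ge0. Qed.

Lemma slice_mass_fin : slice_mass \is a fin_num.
Proof.
rewrite ge0_fin_numE ?slice_mass_ge0//.
have := @eilenberg R n pi _ (s - 1)%R (lproj_lip_gt0 theta) t0 (lproj_lip theta) E.
rewrite -sE => /(_ attractor_fin)[v [mv v0 hv iv]].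
apply: (@le_lt_trans _ _ (\int[leb]_x v x)).
  apply: ge0_le_integral => //=; [by move=> x _; exact: outer_measure_ge0|].
  by apply: measurable_compact_slice; have [] := hE.
by apply: (le_lt_trans iv); rewrite -(fineK HEf) -EFinM ltry.
Qed.

(** The slices scale with exponent [s - 1] and the line with exponent 1. *)
Lemma slice_mass_piece w : \int[leb]_x h (wm w @` E) x = (wl w `^ s)%:E * slice_mass.
Proof.
have wl0 := wl_gt0 hlam w; have [_ cE _] := hE.
rewrite (integral_affine (pi (wm w 0)) wl0); last 2 first.
- by apply: measurable_compact_slice; exact: compact_piece.
- by move=> x; exact: outer_measure_ge0.
under eq_integral do rewrite slice_piece.
rewrite ge0_integralZl//=; last 3 first.
- exact: measurable_compact_slice.
- by move=> x _; exact: outer_measure_ge0.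
- by rewrite lee_fin powR_ge0.
by rewrite muleA -EFinM mulr_powRB1 ?(ltW wl0)// (lt_le_trans _ dim_ge1).
Qed.

(** A cover of the slices over an open set [O] by sets with a small sum of gauges
    bounds the density of the projected measure on [O]: a cylinder of size [r]
    has mass at most [M * r `^ (s - 1) * leb B] over [B], and each member of the
    cover meets boundedly many cylinders of its own size. *)
Lemma density_le_slice : exists2 N : R, (0 <= N)%R &
  forall c O F, (0 <= c)%R -> fcover (s - 1) 1 c (E `&` pi @^-1` O) F ->
    forall B, measurable B -> B `<=` O -> H (E `&` pi @^-1` B) <= (N * c)%:E * leb B.
Proof.
have [_ cE _] := hE.
have [lm [lM [/andP[lm0 lm1] lM1 lM0 hl]]] := lam_bounds hlam.
have [N HN] := cutset_count hlam hosc (compact_bounded cE) hl lm0 lM1 lM0.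
exists (N%:R * M)%R; first by rewrite mulr_ge0.
move=> c W F c0 [HF EF Fc] B mB BW.
have piece w : H ((wm w @` E) `&` pi @^-1` B) <= (wl w `^ (s - 1) * M)%:E * leb B.
  have wl0 := wl_gt0 hlam w.
  pose B' := (fun x => wl w * x + pi (wm w 0))%R @^-1` B.
  have -> : (wm w @` E) `&` pi @^-1` B = wm w @` (E `&` pi @^-1` B').
    apply/seteqP; split => x.
      move=> [[z Ez <-] /=] Bz; exists z => //; split => //.
      by rewrite /B' /= -lproj_affine -(wmap_affine lam d).
    move=> [z [Ez zB] <-]; split; first by exists z.
    by move: zB; rewrite /B' /= -lproj_affine -(wmap_affine lam d).
  rewrite (@hausdorff_wmap _ _ _ lam d hlam)//.
  apply: (@le_trans _ _ ((wl w `^ s)%:E * (M%:E * leb B'))).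
    rewrite lee_wpmul2l ?lee_fin ?powR_ge0//; apply: hM.
    exact: measurable_preimage_affine.
  rewrite /B' lebesgue_preimage_affine// !muleA -!EFinM lee_wpmul2r//.
  rewrite lee_fin -(@mulr_powRB1 _ (wl w) s)// ?(ltW wl0)//; last exact: lt_le_trans dim_ge1.
  by rewrite le_eqVlt; apply/orP; left; apply/eqP; field; rewrite gt_eqF.
have [||k Hk] := @expr_le_seq R lM [seq q.2 | q <- F]; first by rewrite lM0.
  by move=> _ /mapP[q /HF[_ /andP[q0 _] _] ->].
have {}Hk q : q \in F -> (lM ^+ k <= q.2)%R.
  by move=> qF; apply: Hk; apply/mapP; exists q.
pose W' (q : set 'rV[R]_n.+1 * R) :=
  undup [seq w <- cutset lam k q.2 | `[< wm w @` E `&` q.1 !=set0 >]].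
apply: (@le_trans _ _ (\sum_(q <- F) H (q.1 `&` (E `&` pi @^-1` B)))).
  apply: outer_measure_seq => x [Ex Bx].
  by have [q qF qx] := EF x (conj Ex (BW _ Bx)); exists q.
apply: (@le_trans _ _ (\sum_(q <- F) (N%:R * M * q.2 `^ (s - 1))%:E * leb B)); last first.
  rewrite -ge0_sume_distrl; last by move=> q _; rewrite lee_fin !mulr_ge0 ?powR_ge0.
  rewrite lee_wpmul2r// sumEFin lee_fin -mulr_sumr ler_wpM2l ?mulr_ge0//.
  exact: ltW.
rewrite big_seq [leRHS]big_seq; apply: lee_sum => q qF.
have [_ /andP[q0 q1] Uq] := HF _ qF.
have lq : (lm * q.2 <= 1)%R by rewrite mulr_ile1// ltW.
apply: (@le_trans _ _ (\sum_(w <- W' q) H (wm w @` E `&` pi @^-1` B))).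
  apply: outer_measure_seq => x [qx [Ex Bx]].
  have [b bk [e Ee bx]] := attractor_words hE k Ex.
  have /hasP[w wk /prefixP[b' bE]] :=
    @cutset_prefix _ _ lam k q.2 b (eq_leq (esym (size_words bk))).
  have wx : (wm w @` E) x.
    exists (wm b' e); first by apply: attractor_sub.
    by rewrite -bx bE wmap_cat.
  exists w => //; rewrite mem_undup mem_filter wk andbT.
  by apply/asboolP; exists x.
apply: (@le_trans _ _ (\sum_(w <- W' q) (q.2 `^ (s - 1) * M)%:E * leb B)).
  rewrite big_seq [leRHS]big_seq; apply: lee_sum => w.
  rewrite mem_undup mem_filter => /andP[_ wk].
  have /andP[_ wr] := cutset_ratio hlam hl lm0 lM1 lM0 (Hk _ qF) lq wk.
  apply: (le_trans (piece w)); rewrite lee_wpmul2r// lee_fin ler_wpM2r//.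
  by apply: ge0_ler_powR => //; rewrite nnegrE ltW// wl_gt0.
rewrite -ge0_sume_distrl; last by move=> w _; rewrite lee_fin mulr_ge0 ?powR_ge0.
rewrite lee_wpmul2r// sumEFin lee_fin big_const_seq count_predT iter_addr_0.
rewrite -[leLHS]mulr_natl -[leRHS]mulrA [(M * _)%R]mulrC ler_wpM2r ?mulr_ge0 ?powR_ge0//.
rewrite ler_nat.
exact: (HN k q.2 q.1 q0 (Hk _ qF) lq Uq).
Qed.

(** If almost every slice were null, then almost every slice would have covers with
    arbitrarily small sums of gauges; by the previous lemma the density of the
    projected measure would be arbitrarily small. *)
Lemma slice_mass_gt0 : 0 < slice_mass.
Proof.
have [_ cE _] := hE; have [N N0 HN] := density_le_slice.
rewrite lt_neqAle slice_mass_ge0 andbT; apply/eqP => sm0.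
have hE0 : {ae leb, forall x, h E x = 0}.
  have /(ae_eq_integral_abs leb measurableT (measurable_compact_slice cE)) :
      \int[leb]_(x in setT) `|h E x| = 0.
    rewrite {1}sm0; apply: eq_integral => x _.
    by rewrite gee0_abs// outer_measure_ge0.
  by apply: ae_imp => x /(_ I).
have [a Ea] := attractor_in_interval.
pose J := `[(- a)%R, a]%classic : set R.
have mJ : measurable J by exact: measurable_itv.
have Jfin : leb J \is a fin_num.
  by rewrite /J lebesgue_measure_itv/=; case: ifP => _; rewrite -?EFinD.
pose rho : {outer_measure set R -> \bar R} := opush (orestr H E) pi.
have rhoE B : rho B = H (E `&` pi @^-1` B) by rewrite setIC.
have key c : (0 < c)%R -> H E <= (N * c)%:E * leb J.
  move=> c0; have -> : H E = rho J by rewrite rhoE; congr H; apply/esym/setIidPl.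
  apply: local_lebesgue_bound => //.
  - by rewrite mulr_ge0// ltW.
  - move=> B mB B0; apply/eqP; rewrite eq_le outer_measure_ge0 andbT rhoE.
    by apply: (le_trans (hM mB)); rewrite B0 mule0.
  - apply: ae_imp hE0 => x hx.
    have cEx : compact (E `&` pi @^-1` [set x]).
      by apply: compact_closedI => //; exact: closed_lproj_fiber.
    have i2 : (0 < 2^-1 :> R)%R by rewrite invr_gt0.
    have [|F HF] := @hcontent_compact_cover R n _ t0 2^-1%R _ c i2 cEx.
      by apply: (le_lt_trans (hcontent_hausdorff _ _ i2)); rewrite hx lte_fin.
    rewrite mulfV// in HF.
    have [W [oW Wx] WF] := fcover_tube (@lproj_continuous _ _ theta) cE HF.
    exists W; split=> // B mB BW; rewrite rhoE.
    exact: (HN c W F (ltW c0) WF).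
move: Epos; rewrite ltNge => /negP; apply; apply/lee_addgt0Pr => e e0.
rewrite add0e; have J0 : (0 <= fine (leb J))%R by rewrite fine_ge0.
have c0 : (0 < e / (N * fine (leb J) + 1))%R.
  by rewrite divr_gt0// ltr_wpDl// mulr_ge0.
apply: (le_trans (key _ c0)); rewrite -(fineK Jfin) -EFinM lee_fin.
rewrite mulrAC mulrA ler_pdivrMr ?ltr_wpDl ?mulr_ge0//.
by rewrite mulrC ler_wpM2l ?ltW// ltrDl.
Qed.

Definition slice_ratio : R := fine slice_mass / fine (H E).
Local Notation K := slice_ratio.

Lemma slice_ratio_gt0 : (0 < K)%R.
Proof.
by rewrite divr_gt0// fine_gt0 ?Epos ?attractor_fin// slice_mass_gt0 -ge0_fin_numE
  ?slice_mass_ge0 ?slice_mass_fin.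
Qed.

Lemma slice_massE : slice_mass = K%:E * H E.
Proof.
rewrite -(fineK HEf) -EFinM /slice_ratio divfK ?fineK ?slice_mass_fin//.
by rewrite gt_eqF// fine_gt0// Epos attractor_fin.
Qed.

(** [C] is the limit of the unions of the cylinders of level [m] meeting it, for
    which the inequality holds by subadditivity. *)
Lemma compact_slice_le C : compact C -> C `<=` E -> \int[leb]_x h C x <= K%:E * H C.
Proof.
move=> cC CE; have [_ cE _] := hE.
have [lm [lM [_ lM1 lM0 hl]]] := lam_bounds hlam.
pose P w := `[< (wm w @` E) `&` C !=set0 >].
pose Cm m := \bigcup_(w in [set w | w \in words m /\ P w]) (wm w @` E).
have CmE m : Cm m `<=` E by move=> _ [w _ [y Ey <-]]; exact: attractor_sub.
have step m : \int[leb]_x h C x <= K%:E * H (Cm m).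
  apply: (@le_trans _ _ (\int[leb]_x \sum_(w <- [seq w <- words m | P w]) h (wm w @` E) x)).
    apply: ge0_le_integral => //=.
    - by move=> x _; exact: outer_measure_ge0.
    - exact: measurable_compact_slice.
    - by apply: emeasurable_sum => w; apply: measurable_compact_slice; exact: compact_piece.
    - move=> x _; apply: outer_measure_seq => z [Cz zx].
      have [w wm' wz] := attractor_words hE m (CE _ Cz); exists w; last by split.
      by rewrite mem_filter wm' andbT; apply/asboolP; exists z.
  rewrite ge0_integral_sum//; last 2 first.
  - by move=> w; apply: measurable_compact_slice; exact: compact_piece.
  - by move=> w x _; exact: outer_measure_ge0.
  under eq_bigr do rewrite slice_mass_piece.
  rewrite -ge0_sume_distrl; last by move=> w _; rewrite lee_fin powR_ge0.
  rewrite sumEFin big_filter slice_massE muleCA lee_wpmul2l ?lee_fin ?(ltW slice_ratio_gt0)//.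
  exact: (hausdorff_words_ge hlam hE hosc hs Epos attractor_fin).
(* The sets [Cm m] decrease to [C], but only the unions [D m] of their tails
   decrease by construction. *)
pose D m := \bigcup_(j in [set j | (m <= j)%N]) Cm j.
have mCm m : H.-caratheodory (Cm m).
  rewrite /Cm (_ : \bigcup_(w in _) _ = \big[setU/set0]_(w <- [seq w <- words m | P w]) (wm w @` E)).
    apply: (@bigsetU_measurable _ (caratheodory_type H)) => w _.
    by apply: hausdorff_closed; apply: compact_closed; [exact: norm_hausdorff|exact: compact_piece].
  rewrite -bigcup_seq; apply: eq_bigcupl; split => w /=; rewrite mem_filter.
    by move=> [-> ->].
  by move=> /andP[].
have mD m : H.-caratheodory (D m).
  by apply: (@bigcup_measurable _ (caratheodory_type H)) => j _; exact: mCm.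
have DC : \bigcap_m D m `<=` C.
  move=> x Dx; apply: contrapT => nCx.
  have [e e0 he] := closed_far (compact_closed (@norm_hausdorff _ _) cC) nCx.
  have [D0 D00 ED0] := bounded_enorm (compact_bounded cE).
  have [del del0 Edel] : exists2 del : R, (0 < del)%R &
      forall y z, E y -> E z -> (enorm (y - z) <= del)%R.
    exists (D0 + D0)%R; first exact: addr_gt0.
    by move=> y z /ED0 yD /ED0 zD; apply: (le_trans (ler_enormB _ _)); rewrite lerD.
  have [|r|m Hm] := @expr_le_seq R lM [:: e / 2 / (del + 1)]%R; first by rewrite lM0.
    by rewrite inE => /eqP ->; rewrite !divr_gt0// addr_gt0.
  have [j /= mj [w [wj /asboolP[_ [[z Ez <-] Cz]]] [y Ey yx]]] := Dx m I.
  have := he _ Cz; rewrite -yx (enorm_wmapB d hlam) leNgt => /negP; apply.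
  apply: (@le_lt_trans _ _ (lM ^+ m * del)%R).
    rewrite ler_pM ?enorm_ge0 ?(ltW (wl_gt0 hlam _))//; last exact: Edel.
    apply: (@le_trans _ _ (lM ^+ size w)%R).
      elim: (w) => [|i v IH]; first by rewrite weight_nil expr0.
      rewrite weight_cons exprS ler_pM ?(ltW (wl_gt0 hlam _))//.
        by case/andP: (hlam i) => /ltW.
      by case/andP: (hl i).
    by rewrite (size_words wj) ler_wiXn2l// ltW.
  have := Hm _ (mem_head _ _); rewrite ler_pdivlMr ?addr_gt0// mulrDr mulr1.
  have := exprn_ge0 m lM0; lra.
have lim : (fun m => K%:E * H (D m)) @ \oo --> K%:E * H (\bigcap_m D m).
  apply: cvgeZl => //; apply: caratheodory_bigcap_cvg => //.
  - by apply: le_lt_trans attractor_fin; apply: le_outer_measure => x [j _ /CmE].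
  - by move=> i j ij; apply/subsetPset => x [k /= jk kx]; exists k => //=; exact: leq_trans jk.
apply: (@le_trans _ _ (K%:E * H (\bigcap_m D m))).
  apply: (cvge_to_ge lim); apply: nearW => m; apply: (le_trans (step m)).
  rewrite lee_wpmul2l ?lee_fin ?(ltW slice_ratio_gt0)//; apply: le_outer_measure.
  by move=> x mx; exists m => /=.
by rewrite lee_wpmul2l ?lee_fin ?(ltW slice_ratio_gt0)//; exact: le_outer_measure.
Qed.

(** The complement of [A] in [E] lies in an intersection of open sets of the same
    measure, whose complements in [E] exhaust [A] up to a null set. *)
Lemma inner_compact A : H.-caratheodory A -> A `<=` E ->
  exists C : (set 'rV[R]_n.+1)^nat, [/\ forall k, compact (C k), forall k, C k `<=` A,
    nondecreasing_seq C & H (A `\` \bigcup_k C k) = 0].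
Proof.
move=> mA AE; have [_ cE _] := hE.
have [G [oG ZG HG]] := hausdorff_Gdelta s0 (E `\` A).
pose C k := E `&` \big[setU/set0]_(i < k.+1) ~` G i.
have CP k x : C k x <-> E x /\ exists2 i, (i <= k)%N & ~ G i x.
  rewrite /C -(bigcup_mkord _ (fun i => ~` G i)); split.
    by move=> [Ex [i /= ik nG]]; split=> //; exists i.
  by move=> [Ex [i ik nG]]; split=> //; exists i.
exists C; split.
- move=> k; apply: compact_closedI => //; apply: closed_bigsetU => i _.
  exact: open_closedC.
- move=> k x /CP[Ex [i _ nG]]; apply: contrapT => nA; apply: nG.
  exact: (ZG x (conj Ex nA) i I).
- move=> i j ij; apply/subsetPset => x /CP[Ex [m mi nG]]; apply/CP; split=> //.
  by exists m => //; exact: leq_trans ij.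
pose X := E `&` \bigcap_k G k.
have -> : A `\` \bigcup_k C k = X `&` A.
  apply/seteqP; split=> x.
    move=> [Ax nC]; split=> //; split; first exact: AE.
    move=> k _; apply: contrapT => nG; apply: nC; exists k => //; apply/CP.
    by split; [exact: AE|exists k].
  move=> [[Ex Gx] Ax]; split=> // -[k _ /CP[_ [i _]]]; apply; exact: Gx.
have XZ : X `&` ~` A = E `\` A.
  by apply/seteqP; split=> x [] => [[Ex _] nA|Ex nA]; split=> //; split=> //; exact: ZG.
have HZf : H (E `\` A) \is a fin_num.
  rewrite ge0_fin_numE ?outer_measure_ge0//; apply: le_lt_trans attractor_fin.
  by apply: le_outer_measure => x [].
have : H X <= H (E `\` A) by apply: le_trans HG; apply: le_outer_measure => x [].
rewrite (mA X) XZ -leeBrDr// subee// => h0.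
by apply/eqP; rewrite eq_le h0 outer_measure_ge0.
Qed.

Local Notation Hs := (hausdorff (s - 1)).

(** The measure of the slices need not be a measurable function of the line for a
    general [A]; it agrees almost everywhere with the limit [g] over the compact
    sets that exhaust [A], as the slices of the remaining null set are almost all
    null. *)
Let measurable_slice_le A : H.-caratheodory A -> A `<=` E -> exists g : R -> \bar R,
  [/\ measurable_fun [set: R] g, forall x, 0 <= g x, \int[leb]_x g x <= K%:E * H A &
    {ae leb, forall x, Hs.-caratheodory (A `&` pi @^-1` [set x]) /\ h A x = g x}].
Proof.
move=> mA AE; have [C [cC CA ndC HN]] := inner_compact mA AE.
have mCx k x : Hs.-caratheodory (C k `&` pi @^-1` [set x]).
  apply: hausdorff_closed; apply: closedI; last exact: closed_lproj_fiber.
  by apply: compact_closed; [exact: norm_hausdorff|exact: cC].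
have ndCx x : nondecreasing_seq (fun k => C k `&` pi @^-1` [set x]).
  move=> i j ij; apply/subsetPset; apply: setSI; exact/subsetPset/ndC.
have cvgC x : h (C k) x @[k --> \oo] --> h (\bigcup_k C k) x.
  by rewrite setI_bigcupl; exact: caratheodory_bigcup_cvg.
have mh k : measurable_fun [set: R] (h (C k)) by exact: measurable_compact_slice.
exists (h (\bigcup_k C k)); split.
- by apply: (emeasurable_fun_cvg (fun k => h (C k))) => // x _; exact: cvgC.
- by move=> x; exact: outer_measure_ge0.
- rewrite (_ : \int[leb]_x _ = \int[leb]_x limn (fun k => h (C k) x)); last first.
    by apply: eq_integral => x _; apply/esym/cvg_lim.
  rewrite monotone_convergence//; last 2 first.
  + by move=> k x _; exact: outer_measure_ge0.
  + by move=> x _ i j ij; apply: le_outer_measure; exact/subsetPset/ndCx.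
  apply: lime_le.
    apply: ereal_nondecreasing_is_cvgn => i j ij; apply: ge0_le_integral.
    - by [].
    - by move=> x _; exact: outer_measure_ge0.
    - exact: mh.
    - exact: mh.
    - by move=> x _; apply: le_outer_measure; exact/subsetPset/ndCx.
  apply: nearW => k; apply: (le_trans (compact_slice_le (cC k) _)).
    exact: subset_trans AE.
  rewrite lee_wpmul2l ?lee_fin ?(ltW slice_ratio_gt0)//; exact: le_outer_measure.
- apply: ae_imp (slice_null HN) => x Nx.
  have Asplit : A `&` pi @^-1` [set x] = (\bigcup_k C k `&` pi @^-1` [set x]) `|`
      (A `\` \bigcup_k C k) `&` pi @^-1` [set x].
    rewrite -setIUl; congr (_ `&` _); rewrite setDUK//.
    by move=> y [k _]; exact: CA.
  have mU : Hs.-caratheodory (\bigcup_k C k `&` pi @^-1` [set x]).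
    by rewrite setI_bigcupl; exact: caratheodory_bigcup.
  split.
    rewrite Asplit; apply: caratheodory_measurable_setU => //.
    exact: null_caratheodory.
  apply/eqP; rewrite eq_le; apply/andP; split.
    by rewrite Asplit -[leRHS]adde0 -[X in _ + X]Nx; exact: outer_measureU2.
  by apply: le_outer_measure; apply: setSI => y [k _]; exact: CA.
Qed.

(** The bounds for [A] and for its complement in [E] add up to the integral of all
    the slices of [E], so that neither is strict. *)
Lemma slice_disintegration A : H.-caratheodory A -> A `<=` E -> exists g : R -> \bar R,
  [/\ measurable_fun [set: R] g, forall x, 0 <= g x, \int[leb]_x g x = K%:E * H A &
    {ae leb, forall x, Hs.-caratheodory (A `&` pi @^-1` [set x]) /\ h A x = g x}].
Proof.
move=> mA AE; have [_ cE _] := hE.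
have mE := measurable_attractor.
have [g [mg g0 ig hg]] := measurable_slice_le mA AE; exists g; split => //.
have [||g' [mg' g'0 ig' hg']] := @measurable_slice_le (E `\` A).
- exact: caratheodory_measurable_setD.
- by move=> x [].
apply/eqP; rewrite eq_le ig/=.
have EA : H E = H A + H (E `\` A) by rewrite (mA E) setIC (setIidl AE).
have HZf : K%:E * H (E `\` A) \is a fin_num.
  rewrite fin_numM// ge0_fin_numE ?outer_measure_ge0//; apply: le_lt_trans attractor_fin.
  by apply: le_outer_measure => x [].
rewrite -(leeD2rE _ _ HZf) -ge0_muleDr ?outer_measure_ge0// -EA -slice_massE.
apply: (@le_trans _ _ (\int[leb]_x g x + \int[leb]_x g' x)); last by rewrite leeD2l.
rewrite -ge0_integralD//; apply: ae_ge0_le_integral => //.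
- by move=> x _; exact: outer_measure_ge0.
- exact: measurable_compact_slice.
- by move=> x _; exact: adde_ge0.
- exact: emeasurable_funD.
apply: ae_imp (ae_and hg hg') => x [[_ <-] [_ <-]] _.
apply: le_trans (outer_measureU2 _ _ _); apply: le_outer_measure.
by rewrite -setIUl setDUK.
Qed.

(** For the part of [E] above [B] this says that the projected measure has density
    [h E / K]. *)
Lemma projection_density B : measurable B ->
  \int[leb]_(x in B) h E x = K%:E * H (E `&` pi @^-1` B).
Proof.
move=> mB; have [_ cE _] := hE.
have [||g [mg g0 <- hg]] := @slice_disintegration (E `&` pi @^-1` B).
- apply: caratheodory_measurable_setI; last exact: lproj_preimage_caratheodory.
  exact: measurable_attractor.
- exact: subIsetl.
rewrite integral_mkcond; apply: ge0_ae_eq_integral => //.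
- apply/(measurable_restrictT _ mB).
  by apply: measurable_funTS; exact: measurable_compact_slice.
- by move=> x _; apply: erestrict_ge0 => y _; exact: outer_measure_ge0.
apply: ae_imp hg => x [_ <-] _; rewrite patchE; case: ifPn => [|/negP] xB.
  congr hausdorff; apply/seteqP; split => y [].
    by move=> Ey yx; split=> //; split=> //=; rewrite yx; exact: set_mem.
  by move=> [].
rewrite (_ : _ `&` _ = set0) ?outer_measure0//; apply/seteqP; split=> // y [[_ yB] yx].
by apply: xB; apply: mem_set; rewrite -yx.
Qed.

(** * Disintegration *)

(** The statement for sets extends to functions by monotone limits; countably many
    exceptional null sets of lines are still negligible. *)
Lemma slice_integral (f : caratheodory_type H -> \bar R) :
  measurable_fun setT f -> (forall x, 0 <= f x) -> exists G : R -> \bar R,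
  [/\ measurable_fun [set: R] G, forall x, 0 <= G x,
    {ae leb, forall x,
      measurable_fun (slice E theta x : set (caratheodory_type Hs)) f /\
      \int[cmeasure Hs]_(y in slice E theta x) f y = G x} &
    \int[leb]_x G x = K%:E * \int[cmeasure H]_(y in E) f y].
Proof.
have mE := measurable_attractor.
have mS := slice_caratheodory.
have K0 : (0 <= K)%R by rewrite ltW// slice_ratio_gt0.
move: f; apply: ge0_measurable_ind.
- move=> A mA; have mAE : H.-caratheodory (A `&` E) by exact: caratheodory_measurable_setI.
  have [g [mg g0 ig hg]] := slice_disintegration mAE (@subIsetr _ A E).
  exists g; split=> //; last first.
    by rewrite ig (@integral_indic _ (caratheodory_type H) _ (cmeasure H)).
  apply: ae_imp hg => x [mAx <-].
  have SE : A `&` E `&` pi @^-1` [set x] = A `&` slice E theta x by rewrite /slice setIA.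
  have mAS : Hs.-caratheodory (A `&` slice E theta x) by rewrite -SE.
  split.
    exact: (@measurable_indic_on _ (caratheodory_type Hs) _ A _ mAS).
  rewrite SE; exact: (@integral_indic_on _ (caratheodory_type Hs) _ (cmeasure Hs) A _ (mS x) mAS).
- move=> k f k0 mf f0 [G [mG G0 hG iG]]; exists (fun x => k%:E * G x); split.
  + exact: measurable_funeM.
  + by move=> x; rewrite mule_ge0.
  + apply: ae_imp hG => x [mfx <-]; split; first exact: measurable_funeM.
    rewrite ge0_integralZl//; exact: mS.
  + rewrite ge0_integralZl// iG muleCA; congr (_ * _).
    by rewrite ge0_integralZl//; exact: measurable_funTS.
- move=> f g mf mg f0 g0 [G [mG G0 hG iG]] [G' [mG' G'0 hG' iG']].
  exists (fun x => G x + G' x); split.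
  + exact: emeasurable_funD.
  + by move=> x; rewrite adde_ge0.
  + apply: ae_imp (ae_and hG hG') => x [[mfx <-] [mgx <-]]; split.
      exact: emeasurable_funD.
    rewrite ge0_integralD//; exact: mS.
  + rewrite ge0_integralD// iG iG' -ge0_muleDr ?integral_ge0//; congr (_ * _).
    by rewrite ge0_integralD//; exact: measurable_funTS.
- move=> F mF F0 ndF HF; have [G HG] := choice HF.
  have mG i : measurable_fun [set: R] (G i) by have [] := HG i.
  have G0 i x : 0 <= G i x by have [] := HG i.
  have hG : {ae leb, forall x, forall i,
      measurable_fun (slice E theta x : set (caratheodory_type Hs)) (F i) /\
      \int[cmeasure Hs]_(y in slice E theta x) F i y = G i x}.
    by apply: ae_foralln => i; have [] := HG i.
  (* the functions [G i] increase almost everywhere only; the [G' i] do everywhere *)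
  pose G' i x := einfs (G ^~ x) i.
  have mG' i : measurable_fun [set: R] (G' i) by exact: measurable_fun_einfs.
  have G'0 i x : 0 <= G' i x by apply: le_ereal_inf_tmp => _ [j _ <-].
  have ndG' x : nondecreasing_seq (G' ^~ x) by exact: nondecreasing_einfs.
  have cvgF x : (forall i,
      measurable_fun (slice E theta x : set (caratheodory_type Hs)) (F i)) ->
      \int[cmeasure Hs]_(y in slice E theta x) F i y @[i --> \oo] -->
      \int[cmeasure Hs]_(y in slice E theta x) limn (F ^~ y).
    move=> mFx; apply: nondecreasing_integral_cvg => //; exact: mS.
  have ndG x : (forall i, measurable_fun (slice E theta x : set (caratheodory_type Hs)) (F i) /\
      \int[cmeasure Hs]_(y in slice E theta x) F i y = G i x) -> nondecreasing_seq (G ^~ x).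
    move=> hx i j ij; have [mi <-] := hx i; have [mj <-] := hx j.
    apply: ge0_le_integral => //; first exact: mS.
    by move=> y _; exact: ndF.
  exists (fun x => limn (G' ^~ x)); split.
  + apply: (emeasurable_fun_cvg G') => // x _.
    by apply: ereal_nondecreasing_is_cvgn; exact: ndG'.
  + move=> x; apply: lime_ge; last exact: nearW.
    by apply: ereal_nondecreasing_is_cvgn; exact: ndG'.
  + apply: ae_imp hG => x hx; have mFx i := (hx i).1; split.
      apply: (@emeasurable_fun_cvg _ (caratheodory_type Hs) R _ F) => // y _.
      by apply: ereal_nondecreasing_is_cvgn; exact: ndF.
    apply/esym/cvg_lim => //.
    rewrite (_ : G' ^~ x = fun i => \int[cmeasure Hs]_(y in slice E theta x) F i y).
      exact: cvgF.
    apply/funext => i; rewrite /G' nondecreasing_einfsE; first by have [_ ->] := hx i.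
    exact: ndG.
  + have h1 := @nondecreasing_integral_cvg _ _ _ leb setT G' measurableT mG'
      (fun i x _ => G'0 i x) (fun x _ => ndG' x).
    have h2 := @nondecreasing_integral_cvg _ _ _ (cmeasure H) E F mE
      (fun i => measurable_funTS (mF i)) (fun i x _ => F0 i x) (fun x _ => ndF x).
    rewrite (_ : (fun i => _) = fun i => K%:E * \int[cmeasure H]_(y in E) F i y) in h1.
      by apply: (cvg_unique _ h1) => //; exact: cvgeZl.
    apply/funext => i; have [_ _ _ <-] := HG i.
    apply: (@ge0_ae_eq_integral _ _ _ leb setT _ _ measurableT (mG' i) (mG i) (fun x _ => G'0 i x) (fun x _ => G0 i x)).
    apply: ae_imp hG => x hx _; rewrite /G' nondecreasing_einfsE//; exact: ndG.
Qed.

Local Notation rho := (nu_proj s E theta).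

Lemma nu_projE B : rho B = H (E `&` pi @^-1` B).
Proof. by rewrite /nu_proj /opush /orestr setIC. Qed.

Lemma borel_nu_proj (B : set R) : measurable B -> rho.-caratheodory B.
Proof.
move=> mB X; transitivity (H (E `&` pi @^-1` X)); first exact: nu_projE.
rewrite (lproj_preimage_caratheodory theta s mB (E `&` pi @^-1` X)) -!setIA.
by congr (_ + _); apply/esym; exact: nu_projE.
Qed.

Lemma nu_proj_null (N : set R) : measurable N -> leb N = 0 -> rho N = 0.
Proof.
move=> mN N0; rewrite nu_projE; apply/eqP; rewrite eq_le outer_measure_ge0 andbT.
by apply: (le_trans (hM mN)); rewrite N0 mule0.
Qed.

Lemma nu_proj_ae (P : R -> Prop) : {ae leb, forall x, P x} -> oae rho P.
Proof.
move=> [N [mN N0 sub]]; exists N.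
by split; [exact: borel_nu_proj|exact: nu_proj_null|exact: sub].
Qed.

Lemma measurable_nu_proj (D : set R) (u : R -> \bar R) : measurable D ->
  measurable_fun [set: R] u -> measurable_fun (D : set (caratheodory_type rho)) u.
Proof.
move=> mD mu _ Y mY; apply: borel_nu_proj; apply: measurableI => //.
by rewrite -[X in measurable X]setTI; exact: mu.
Qed.

Lemma measurable_shadow : measurable (pi @` E : set R).
Proof.
have [_ cE _] := hE; apply: closed_measurable; apply: compact_closed; first exact: Rhausdorff.
apply: continuous_compact => //; apply: continuous_subspaceT; exact: lproj_continuous.
Qed.

Let mh : measurable_fun [set: R] (h E).
Proof. by apply: measurable_compact_slice; have [] := hE. Qed.

Lemma slice_fin_ae : {ae leb, forall x, h E x < +oo}.
Proof.
have : {ae leb, forall x, setT x -> h E x \is a fin_num}.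
  apply: integrable_ae => //; apply/integrableP; split=> //.
  rewrite (_ : \int[leb]_(x in setT) _ = slice_mass); first by rewrite ltey_eq slice_mass_fin.
  by apply: eq_integral => x _; rewrite gee0_abs// outer_measure_ge0.
by apply: ae_imp => x /(_ I); rewrite ge0_fin_numE// outer_measure_ge0.
Qed.

(** The lines with a null slice are negligible because the projected measure has
    density 0 there. *)
Lemma slice_pos_ae : oae rho (fun x => 0 < h E x < +oo).
Proof.
have [N [mN N0 sub]] := slice_fin_ae.
pose Z := [set x | h E x = 0].
have mZ : measurable (Z : set R).
  rewrite (_ : Z = setT `&` h E @^-1` [set 0]); last by rewrite setTI.
  exact: mh.
exists (N `|` Z); split; first exact: (borel_nu_proj (measurableU _ _ mN mZ)).
  apply/eqP; rewrite eq_le outer_measure_ge0 andbT.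
  apply: (le_trans (outer_measureU2 _ _ _)).
  rewrite [X in X + _](nu_proj_null mN N0) add0e [leLHS]nu_projE.
  rewrite -(@lee_pmul2l _ K%:E)// ?lte_fin ?slice_ratio_gt0// mule0.
  rewrite -(projection_density mZ).
  by rewrite (eq_integral (cst 0)) ?integral0// => x /set_mem.
move=> x /= nx; have [Zx|Zx] := pselect (Z x); [by right|left].
apply: sub => /= hx; apply: nx; rewrite hx andbT lt_neqAle outer_measure_ge0 andbT eq_sym.
exact/eqP.
Qed.

Lemma nu_proj_integral (u : R -> \bar R) :
  measurable_fun [set: R] u -> (forall x, 0 <= u x) ->
  K%:E * \int[cmeasure rho]_(x in pi @` E) u x = \int[leb]_x (u x * (fine (h E x))%:E).
Proof.
move=> mu u0; have K0 := slice_ratio_gt0.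
pose phi : caratheodory_type rho -> measurableTypeR R := idfun.
have mphi : measurable_fun setT phi.
  by move=> _ B mB; rewrite setTI; exact: borel_nu_proj.
pose push : {measure set (measurableTypeR R) -> \bar R} :=
  measure_function_pushforward__canonical__measure_function_Measure (cmeasure rho) mphi.
have mD := measurable_shadow.
transitivity (K%:E * \int[cmeasure rho]_x u x).
  have mN : rho.-caratheodory (~` (pi @` E)) by apply: borel_nu_proj; exact: measurableC.
  have N0 : rho (~` (pi @` E)) = 0.
    rewrite nu_projE (_ : _ `&` _ = set0) ?outer_measure0//.
    by apply/seteqP; split=> // x [Ex]; apply; exists x.
  have := @ge0_negligible_integral _ _ _ (cmeasure rho) setT (~` (pi @` E)) u mN
    measurableT (measurable_nu_proj measurableT mu) (fun x _ => u0 x) N0.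
  by rewrite setTD setCK => ->.
transitivity (\int[mscale (NngNum (ltW K0)) push]_x u x).
  rewrite ge0_integral_mscale//; congr (_ * _); apply/esym.
  exact: (@ge0_integral_pushforward _ _ _ _ _ _ mphi (cmeasure rho) setT u measurableT mu
    (fun y _ => u0 y)).
apply: (@ge0_integral_density _ _ _ leb) => //.
- exact: measurableT_comp.
- by move=> x; rewrite fine_ge0// outer_measure_ge0.
- move=> B mB; rewrite [LHS](_ : _ = K%:E * rho B)// nu_projE -(projection_density mB).
  apply: (@ge0_ae_eq_integral _ _ _ leb B) => //.
  + exact: measurable_funTS.
  + by apply/measurable_EFinP; apply: measurable_funTS; exact: measurableT_comp.
  + by move=> x _; exact: outer_measure_ge0.
  + by move=> x _; rewrite lee_fin fine_ge0// outer_measure_ge0.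
  apply: ae_imp slice_fin_ae => x hx _; rewrite fineK//.
  by rewrite ge0_fin_numE// outer_measure_ge0.
Qed.

Lemma normalized_slice (f : 'rV[R]_n.+1 -> \bar R) x : 0 < h E x < +oo ->
  (forall y, 0 <= f y) ->
  measurable_fun (slice E theta x : set (caratheodory_type Hs)) f ->
  measurable_fun (slice E theta x : set (caratheodory_type (mu2 s E theta x))) f /\
  \int[cmeasure (mu2 s E theta x)]_(y in slice E theta x) f y =
    ((fine (h E x))^-1)%:E * \int[cmeasure Hs]_(y in slice E theta x) f y.
Proof.
move=> /andP[h0 hfin] f0 mf; set D := slice E theta x; set c := fine (h E x).
have hE1 : Hs D = c%:E by rewrite fineK// ge0_fin_numE// ltW.
have c0 : (0 < c)%R by rewrite -lte_fin -hE1.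
have mu2E A : mu2 s E theta x A = c^-1%:E * Hs (A `&` D).
  transitivity (Hs (A `&` D) * (Hs D)^-1); first by [].
  by rewrite hE1 muleC inver gt_eqF.
have cara A : Hs.-caratheodory A -> (mu2 s E theta x).-caratheodory A.
  exact: onormalize_caratheodory.
have sc0 : (0 <= c^-1)%R by rewrite invr_ge0 ltW.
split; first exact: (@measurable_fun_transfer _ _ (mu2 s E theta x) Hs D (slice_caratheodory x) cara f mf).
have m12 A : A `<=` D -> mu2 s E theta x A = c^-1%:E * Hs A.
  by move=> AD; rewrite mu2E (setIidl AD).
exact: (@integral_transfer _ _ (mu2 s E theta x) Hs D _ sc0 (slice_caratheodory x) m12 cara f
  mf (fun y _ => f0 y)).
Qed.

(** The normalising factor is cancelled by the density of the projected measure; on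
    the lines with a null slice both sides vanish. *)
Lemma disintegration_ge0 (f : 'rV[R]_n.+1 -> \bar R) : (forall y, 0 <= f y) ->
  measurable_fun (E : set (caratheodory_type H)) f -> exists u : R -> \bar R,
  [/\ measurable_fun [set: R] u, forall x, 0 <= u x,
    oae rho (fun x =>
      measurable_fun (slice E theta x : set (caratheodory_type (mu2 s E theta x))) f /\
      \int[cmeasure (mu2 s E theta x)]_(y in slice E theta x) f y = u x) &
    \int[cmeasure rho]_(x in pi @` E) u x = \int[cmeasure H]_(y in E) f y].
Proof.
move=> f0 mf; have mE := measurable_attractor.
pose g : caratheodory_type H -> \bar R := f \_ E.
have mg : measurable_fun setT g by exact/(@measurable_restrictT _ _ (caratheodory_type H) _ E f mE).
have g0 y : 0 <= g y by apply: erestrict_ge0.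
have [G [mG G0 hG iG]] := slice_integral mg g0.
have {}hG : {ae leb, forall x,
    measurable_fun (slice E theta x : set (caratheodory_type Hs)) f /\
    \int[cmeasure Hs]_(y in slice E theta x) f y = G x}.
  apply: ae_imp hG => x [mx <-].
  have gf : {in slice E theta x, g =1 f}.
    by move=> y /set_mem[Ey _]; rewrite /g patchE mem_set.
  split; first exact: (@eq_measurable_fun _ _ (caratheodory_type Hs) _ (slice E theta x) g f gf mx).
  by apply: eq_integral => y yx; rewrite gf.
have mfh : measurable_fun [set: R] (fun x => fine (h E x)) by exact: measurableT_comp.
(* the inverse is written as a power, which is a measurable function *)
pose u x := G x * (fine (h E x) `^ (-1))%:E.
have mu : measurable_fun [set: R] u.
  apply: emeasurable_funM => //; apply/measurable_EFinP.
  exact: (measurableT_comp (measurable_powR (-1)%R) mfh).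
have u0 x : 0 <= u x by rewrite mule_ge0// lee_fin powR_ge0.
exists u; split=> //.
- have := @ae_and _ (caratheodory_type rho) R (cmeasure rho) _ _ slice_pos_ae (nu_proj_ae hG).
  apply: ae_imp => x [hx [mx Gx]].
  have [mfx ->] := normalized_slice hx f0 mx; split => //.
  rewrite Gx /u muleC powR_inv1// fine_ge0//; exact: outer_measure_ge0.
- suff : K%:E * \int[cmeasure rho]_(x in pi @` E) u x = K%:E * \int[cmeasure H]_(y in E) f y.
    move=> /(congr1 (fun z => K^-1%:E * z)).
    by rewrite !muleA -!EFinM mulVf ?mul1e// gt_eqF// slice_ratio_gt0.
  have -> : \int[cmeasure H]_(y in E) f y = \int[cmeasure H]_(y in E) g y.
    by apply: eq_integral => y yE; rewrite /g patchE yE.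
  rewrite nu_proj_integral// -iG.
  apply: (@ge0_ae_eq_integral _ _ _ leb setT) => //.
  + by apply: emeasurable_funM => //; exact/measurable_EFinP.
  + by move=> x _; rewrite mule_ge0// lee_fin fine_ge0// outer_measure_ge0.
  apply: ae_imp (ae_and slice_fin_ae hG) => x [hfin [mx Gx]] _.
  have hf : h E x \is a fin_num by rewrite ge0_fin_numE// outer_measure_ge0.
  rewrite /u -muleA -EFinM; have [h0|h0] := eqVneq (fine (h E x)) 0%R.
    rewrite -Gx (@null_set_integral _ _ _ (cmeasure Hs))// ?mul0e//.
    + exact: slice_caratheodory.
    + by rewrite -[LHS](fineK hf) h0.
  rewrite powR_inv1 ?fine_ge0 ?outer_measure_ge0// mulVf// mule1//.
Qed.

(** The nonnegative case applies to both parts of [f]. The integrals over the slices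
    agree almost everywhere with a difference [u \- v] of Borel functions, hence are
    integrable themselves, the projected measure being complete. *)
Lemma disintegration (f : 'rV[R]_n.+1 -> R) :
  ointegrable (orestr H E) E (EFin \o f) ->
  [/\ oae rho (fun x => (pi @` E) x ->
        ointegrable (mu2 s E theta x) (slice E theta x) (EFin \o f)),
      ointegrable rho (pi @` E) (fun x =>
        ointegral (mu2 s E theta x) (slice E theta x) (EFin \o f)) &
      ointegral H E (EFin \o f) = ointegral rho (pi @` E) (fun x =>
        ointegral (mu2 s E theta x) (slice E theta x) (EFin \o f))].
Proof.
have mE := measurable_attractor.
move=> /(orestr_integrable mE) fi; have /integrableP[mf _] := fi.
pose F := EFin \o f; pose D := pi @` E.
have mD : rho.-caratheodory D by apply: borel_nu_proj; exact: measurable_shadow.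
have mDb : measurable (D : set R) by exact: measurable_shadow.
have part (g : 'rV[R]_n.+1 -> \bar R) : (forall y, 0 <= g y) ->
    (cmeasure H).-integrable E g -> exists u : R -> \bar R,
    [/\ (cmeasure rho).-integrable D u, forall x, 0 <= u x,
      oae rho (fun x => D x -> u x \is a fin_num /\
        ointegrable (mu2 s E theta x) (slice E theta x) g /\
        ointegral (mu2 s E theta x) (slice E theta x) g = u x) &
      ointegral rho D u = ointegral H E g].
  move=> g0 /integrableP[mg gi]; have [u [mu u0 hu iu]] := disintegration_ge0 g0 mg.
  have ui : (cmeasure rho).-integrable D u.
    apply/integrableP; split; first exact: measurable_nu_proj.
    have -> : \int[cmeasure rho]_(x in D) `|u x| = \int[cmeasure rho]_(x in D) u x.
      by apply: eq_integral => x _; rewrite gee0_abs.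
    rewrite iu; have -> : \int[cmeasure H]_(y in E) g y = \int[cmeasure H]_(y in E) `|g y|.
      by apply: eq_integral => y _; rewrite gee0_abs.
    exact: gi.
  exists u; split => //; have uf := @integrable_ae _ (caratheodory_type rho) R (cmeasure rho) D mD u ui.
  have := @ae_and _ (caratheodory_type rho) R (cmeasure rho) _ _ uf hu.
  apply: ae_imp => x [uxf [mx gx]] Dx; split; [exact: uxf|split; last exact: gx].
  apply/integrableP; split; first exact: mx.
  have -> : \int[cmeasure (mu2 s E theta x)]_(y in slice E theta x) `|g y| =
      \int[cmeasure (mu2 s E theta x)]_(y in slice E theta x) g y.
    by apply: eq_integral => y _; rewrite gee0_abs.
  by rewrite gx ltey_eq uxf.
have Fpi : (cmeasure H).-integrable E F^\+ by exact: integrable_funepos.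
have Fni : (cmeasure H).-integrable E F^\- by exact: integrable_funeneg.
have [u [ui u0 hu iu]] := part _ (funepos_ge0 F) Fpi.
have [v [vi v0 hv iv]] := part _ (funeneg_ge0 F) Fni.
have huv := @ae_and _ (caratheodory_type rho) R (cmeasure rho) _ _ hu hv.
have Fx : oae rho (fun x => D x ->
    (u \- v) x = ointegral (mu2 s E theta x) (slice E theta x) F).
  apply: ae_imp huv => x [hux hvx] Dx.
  have [_ [_ /= <-]] := hux Dx; have [_ [_ <-]] := hvx Dx.
  by rewrite /ointegral [RHS]integralE.
have uvi : (cmeasure rho).-integrable D (u \- v) by exact: integrableB.
have [I1 I2] := ae_eq_integrable mD Fx uvi.
split=> //.
  apply: ae_imp huv => x [hux hvx] Dx.
  have [_ [fpi _]] := hux Dx; have [_ [fni _]] := hvx Dx.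
  have mS : (mu2 s E theta x).-caratheodory (slice E theta x).
    by apply: onormalize_caratheodory; exact: slice_caratheodory x.
  rewrite [EFin \o f]funeposneg.
  exact: (@integrableB _ _ _ (cmeasure (mu2 s E theta x)) _ mS _ _ fpi fni).
rewrite -I2 [RHS](@integralB _ _ _ (cmeasure rho) D mD u v ui vi) /ointegral [LHS]integralE.
by congr (_ - _); apply/esym.
Qed.

End BoundedProjection.

Section BoundedDensity.
Local Open Scope ereal_scope.
Context {R : realType} {n : nat}.

Lemma ac_bounded_density_le (nu : set R -> \bar R) : ac_bounded_density nu ->
  exists2 M : R, (0 <= M)%R & forall B : set R, measurable B -> nu B <= M%:E * lebesgue_measure B.
Proof.
move=> [_ [g [mg g0 gfin nug]]].
have [M M0 gM] : exists2 M : R, (0 <= M)%R & ess_sup lebesgue_measure (EFin \o g) <= M%:E.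
  case: (ess_sup _ _) gfin => [r| |] // _.
    by exists `|r|%R; rewrite // lee_fin ler_norm.
  by exists 0%R; rewrite ?leNye.
exists M => // B mB; rewrite nug// -integral_cst//.
have mgB : measurable_fun B (fun x => (g x)%:E).
  by apply/measurable_EFinP; exact: measurable_funTS.
apply: ae_ge0_le_integral => //.
- by move=> x _; rewrite lee_fin.
have : {ae (@lebesgue_measure R), forall x, (EFin \o g) x <= ess_sup (@lebesgue_measure R) (EFin \o g)}.
  exact: ess_sup_ge.
by apply: ae_imp => x gx _; exact: le_trans gM.
Qed.

End BoundedDensity.

Theorem theorem6p2 (R : realType) (n l : nat)
    (lam : 'I_l -> R) (d : 'I_l -> 'rV[R]_n.+1) (E : set 'rV[R]_n.+1)
    (s : R) (theta : 'I_n -> R)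
    (hlam : forall i, 0 < lam i < 1)
    (hE : is_attractor lam d E)
    (hosc : open_set_condition lam d)
    (hsc : slice_coding lam d E)
    (hs : hausdorff_dim E = s%:E)
    (hac : ac_bounded_density (nu_proj s E theta)) :
  oae (nu_proj s E theta) (fun x => (lproj theta @` E) x ->
    (0 < hausdorff (s - 1) (slice E theta x) < +oo)%E) /\
  forall f : 'rV[R]_n.+1 -> R,
    ointegrable (orestr (hausdorff s) E) E (EFin \o f) ->
    [/\ oae (nu_proj s E theta) (fun x => (lproj theta @` E) x ->
          ointegrable (mu2 s E theta x) (slice E theta x) (EFin \o f)),
        ointegrable (nu_proj s E theta) (lproj theta @` E) (fun x =>
          ointegral (mu2 s E theta x) (slice E theta x) (EFin \o f)) &
        ointegral (hausdorff s) E (EFin \o f) =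
        ointegral (nu_proj s E theta) (lproj theta @` E) (fun x =>
          ointegral (mu2 s E theta x) (slice E theta x) (EFin \o f))].
Proof.
have [H0|H0] := eqVneq (hausdorff s E) 0%E.
  (* all measures in sight vanish *)
  have rho0 D : nu_proj s E theta D = 0%E.
    apply/eqP; rewrite eq_le outer_measure_ge0 andbT -H0.
    by apply: le_outer_measure; exact: subIsetr.
  have ae0 P : oae (nu_proj s E theta) P.
    by exists setT; split=> //; exact: rho0.
  split=> [|f _]; first exact: ae0.
  have [I1 I2] := @null_integral _ _ (nu_proj s E theta) (lproj theta @` E) (fun x =>
    ointegral (mu2 s E theta x) (slice E theta x) (EFin \o f)) (rho0 _).
  split; [exact: ae0|exact: I1|].
  have [_ ->] := @null_integral _ _ (hausdorff s) E (EFin \o f) H0.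
  exact/esym.
have Epos : (0 < hausdorff s E)%E by rewrite lt_neqAle eq_sym H0 outer_measure_ge0.
have [M M0 nuM] := ac_bounded_density_le hac.
have hM (B : set R) : measurable B ->
    (hausdorff s (E `&` lproj theta @^-1` B) <= M%:E * lebesgue_measure B)%E.
  by move=> mB; rewrite -nu_projE; exact: nuM.
split=> [|f]; last exact: (disintegration hlam hE hosc hs Epos M0 hM).
by apply: ae_imp (slice_pos_ae hlam hE hosc hs Epos M0 hM) => x hx _.
Qed.
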